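(* One has the equality of sets $\tilde H_{1,W}(\mathbb T^d)=H_{1,W}(\mathbb T^d)$. In particular, any function $f\in\tilde H_{1,W}(\mathbb T^d)$ can be approximated by functions in $\mathbb D_W$ (with respect to the norm $\|\cdot\|_{1,W}$).
   Context: $\mathbb T=\mathbb R/\mathbb Z=[0,1)$ and $\mathbb T^d=[0,1)^d$ is the $d$-dimensional torus; $\langle\cdot,\cdot\rangle$ is the inner product of $L^2(\mathbb T^d)$ (Lebesgue measure). $W(x)=\sum_{k=1}^dW_k(x_k)$, $x\in\mathbb R^d$, where each $W_k:\mathbb R\to\mathbb R$ is strictly increasing, right continuous with left limits, and satisfies $W_k(u+1)-W_k(u)=W_k(1)-W_k(0)$ for all $u$. $dW_k$ is the measure induced by $W_k$ on $\mathbb T$. The generalized derivative is $\partial_{W_k}f(x)=\lim_{\epsilon\to0}\frac{f(x+\epsilon e_k)-f(x)}{W_k(x_k+\epsilon)-W_k(x_k)}$ when the limit exists and is finite. One-dimensional operator: $\mathcal D_{W_k}$ is the set of $f\in L^2(\mathbb T)$ of the form $f(x)=a+bW_k(x)+\int_{(0,x]}W_k(dy)\int_0^y\mathfrak f(z)\,dz$ with $\mathfrak f\in L^2(\mathbb T)$, $\int_0^1\mathfrak f(z)\,dz=0$ and $\int_{(0,1]}W_k(dy)\{b+\int_0^y\mathfrak f(z)\,dz\}=0$; on $\mathcal D_{W_k}$, $\mathcal L_{W_k}f=\partial_{x_k}\partial_{W_k}f$ (with $\partial_{W_k}f(x)=b+\int_0^x\mathfrak f(z)\,dz$ and $\mathcal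 L_{W_k}f=\mathfrak f$). $\mathcal A_{W_k}$ is a countable complete orthonormal system of $L^2(\mathbb T)$ consisting of eigenvectors of $\mathcal L_{W_k}$. $\mathcal A_W=\{f:\ f(x)=\prod_{k=1}^df_k(x_k),\ f_k\in\mathcal A_{W_k}\}$ and $\mathbb D_W=\mathrm{span}(\mathcal A_W)$. For $f\in\mathbb D_W$, $\partial_{W_i}f$ and $\partial_{x_i}\partial_{W_i}f$ act on the $i$th coordinate with the others fixed, and $\mathbb L_Wf=\sum_{i=1}^d\partial_{x_i}\partial_{W_i}f$. $d(x^i\otimes W_i)=dx_1\cdots dx_{i-1}\,dW_i\,dx_{i+1}\cdots dx_d$ on $\mathbb T^d$; $L^2_{x^i\otimes W_i}(\mathbb T^d)$ is the corresponding $L^2$ space, and $L^2_{x^i\otimes W_i,0}(\mathbb T^d)$ is its closed subspace of functions $f$ with zero mean, $\int_{\mathbb T^d}f\,d(x^i\otimes W_i)=0$. $\tilde H_{1,W}(\mathbb T^d)$ (the $W$-Sobolev space) is the set of $g\in L^2(\mathbb T^d)$ such that for each $i=1,\dots,d$ there is $G_i\in L^2_{x^i\otimes W_i,0}(\mathbb T^d)$ with $\int_{\mathbb T^d}(\partial_{x_i}\partial_{W_i}f)\,g\,dx=-\int_{\mathbb T^d}(\partial_{W_i}f)\,G_i\,d(x^i\otimes W_i)$ for all $f\in\mathbb D_W$; the (unique) $G_i$ is denoted $\partial_{W_i}g$, the $i$th generalized weak derivative. Its inner product is $\langle f,g\rangle_{1,W}=\langle f,g\rangle+\sum_{i=1}^d\int_{\mathbb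 T^d}(\partial_{W_i}f)(\partial_{W_i}g)\,d(x^i\otimes W_i)$, with norm $\|\cdot\|_{1,W}$. $H_{1,W}(\mathbb T^d)$ (the energetic space) is the set of $f\in L^2(\mathbb T^d)$ for which there is a sequence $(f_n)$ in $\mathbb D_W$ converging to $f$ in $L^2(\mathbb T^d)$ that is Cauchy for the inner product on $\mathbb D_W$ given by $\langle f,g\rangle_{1,W}=\langle f,g\rangle+\langle-\mathbb L_Wf,g\rangle$; on $H_{1,W}(\mathbb T^d)$ the inner product is $\lim_n\langle f_n,g_n\rangle_{1,W}$ along such sequences.
   Formalization: The weak derivatives of f are not unique for d ≥ 2 (a zero-mean function of the other coordinates can be added), so the approximation in the norm ‖·‖_{1,W} is stated for some choice of weak derivatives G_i of f, with f_n − f having weak derivatives ∂_{W_i}f_n − G_i. *)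

(* Defs.v *)
From HB Require Import structures.
From mathcomp Require Import all_boot all_order all_algebra.
From mathcomp Require Import all_classical all_reals all_analysis.

Set Implicit Arguments.
Unset Strict Implicit.
Unset Printing Implicit Defensive.
Import Order.TTheory GRing.Theory Num.Theory.
Import numFieldNormedType.Exports.
Local Open Scope classical_set_scope.
Local Open Scope ring_scope.

(* Product of n finite measures on T, as a measure on n.-tuple T. *)
Section tuple_measure.
Context {R : realType} {disp : measure_display} {T : measurableType disp}.

Section cons_measure.
Variables (n : nat) (m1 : {finite_measure set T -> \bar R})
  (m2 : {finite_measure set (n.-tuple T) -> \bar R}).

Let consf (p : T * n.-tuple T) : n.+1.-tuple T := [tuple of p.1 :: p.2].

Let measurable_consf : measurable_fun setT consf.
Proof. exact: measurable_cons. Qed.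

Definition cons_measure := pushforward (m1 \x m2)%E consf.

Let cons_measure0 : cons_measure set0 = 0%E.
Proof. by rewrite /cons_measure /pushforward preimage_set0 measure0. Qed.

Let cons_measure_ge0 A : (0 <= cons_measure A)%E.
Proof. exact: measure_ge0. Qed.

Let cons_measure_sigma_additive : semi_sigma_additive cons_measure.
Proof. exact: (measure_semi_sigma_additive (s := pushforward (m1 \x m2)%E consf)). Qed.

HB.instance Definition _ := isMeasure.Build _ _ _ cons_measure
  cons_measure0 cons_measure_ge0 cons_measure_sigma_additive.

Let cons_measure_fin : fin_num_fun cons_measure.
Proof.
move=> A mA; rewrite ge0_fin_numE//.
have mT : cons_measure setT = (m1 setT * m2 setT)%E.
  by rewrite /cons_measure /pushforward preimage_setT -setXTT product_measure1E.
apply: (@le_lt_trans _ _ (cons_measure setT)).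
  by apply: le_measure; rewrite ?inE.
by rewrite mT lte_mul_pinfty// ?fin_num_measure// -ge0_fin_numE// fin_num_measure.
Qed.

HB.instance Definition _ :=
  Measure_isFinite.Build _ _ _ cons_measure cons_measure_fin.

End cons_measure.

Fixpoint tuple_measure (n : nat) :
    ('I_n -> {finite_measure set T -> \bar R}) ->
    {finite_measure set (n.-tuple T) -> \bar R} :=
  match n with
  | 0%N => fun _ => \d_([tuple] : 0.-tuple T)
  | n'.+1 => fun mu =>
      cons_measure (mu ord0) (tuple_measure (fun i => mu (lift ord0 i)))
  end.

End tuple_measure.

(* The torus T = [0,1) is represented by R with finite measures carried by
   [0,1); T^d is represented in the same way by d.-tuple (measurableTypeR R).  As an element of
   L^2 a function on the torus is thus a measurable function on R (or
   d.-tuple (measurableTypeR R)) whose values off [0,1) (or [0,1)^d) are irrelevant; only the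
   functions that get differentiated are required to be 1-periodic. *)
Section torus.
Context {R : realType}.
Implicit Types V : cumulative R R.

Lemma lebesgue_stieltjes_torus_fin V :
  (lebesgue_stieltjes_measure V (`[0%R, 1%R[ : set (measurableTypeR R)) < +oo)%E.
Proof.
apply: (@le_lt_trans _ _
    (lebesgue_stieltjes_measure V (`](-1)%R, 1%R] : set (measurableTypeR R)))).
  apply: le_measure; rewrite ?inE; [exact: measurable_itv..|].
  move=> x /=; rewrite !in_itv/= => /andP[x0 x1].
  by rewrite (lt_le_trans _ x0)//= ltW.
rewrite /lebesgue_stieltjes_measure /measure_extension/=.
rewrite measurable_mu_extE/=; last exact: is_ocitv.
by rewrite wlength_itv/=; case: ifPn => // _; rewrite -EFinB ltry.
Qed.

(* dV on the torus: since V(u+1) - V(u) is constant, the atom of dV at 0 ~ 1,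
   V 0 - V 0^-, is also V 1 - V 1^-. *)
Definition dW_torus V : {finite_measure set (measurableTypeR R) -> \bar R} :=
  mfrestr (T := measurableTypeR R) (measurable_itv `[0%R, 1%R[) (lebesgue_stieltjes_torus_fin V).

Definition dx_torus : {finite_measure set (measurableTypeR R) -> \bar R} := dW_torus idfun.

Definition dx (d : nat) : {finite_measure set (d.-tuple (measurableTypeR R)) -> \bar R} :=
  tuple_measure (fun _ => dx_torus).

Definition dxW (d : nat) (W : 'I_d -> cumulative R R) (i : 'I_d) :
    {finite_measure set (d.-tuple (measurableTypeR R)) -> \bar R} :=
  tuple_measure (fun k => if k == i then dW_torus (W i) else dx_torus).

(* Right continuity is part of [cumulative]; left limits exist by
   monotonicity. *)
Definition W_admissible V :=
  {homo V : x y / x < y} /\ forall u, V (u + 1) - V u = V 1 - V 0.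

End torus.

Section inner_product.
Context {R : realType} {disp : measure_display} {T : measurableType disp}.
Implicit Types mu : {measure set T -> \bar R}.

Definition ip mu (f g : T -> R) : R := \int[mu]_x (f x * g x).

Definition L2norm mu (f : T -> R) : R := Num.sqrt (ip mu f f).

End inner_product.

Section one_dim.
Context {R : realType} (V : cumulative R R).

(* [lim] returns a default value where the limit does not exist.  For f in the
   span of eigenvectors below the limit exists everywhere. *)
Definition generalized_derivative (f : R -> R) (u : R) : R :=
  lim ((f (u + e) - f u) / (V (u + e) - V u) @[e --> 0^']).

(* [L_graph f ff]: f belongs to the domain D_V of the one-dimensional operator
   L_V and L_V f = ff in L^2(T). *)
Definition L_graph (f ff : R -> R) : Prop :=
  let F y := \int[lebesgue_measure]_(z in `[0, y]) ff z in
  let muV := lebesgue_stieltjes_measure V in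
  [/\ f \in Lfun dx_torus 2%:E, forall u, f (u + 1) = f u,
      ff \in Lfun dx_torus 2%:E, \int[dx_torus]_z ff z = 0 &
      exists a b : R,
        \int[muV]_(y in `]0, 1]) (b + F y) = 0 /\
        forall x, 0 <= x < 1 ->
          f x = a + b * V x + \int[muV]_(y in `]0, x]) F y].

Definition eigenvector (f : R -> R) : Prop :=
  ~ {ae dx_torus, forall x, f x = 0} /\
  exists lambda : R, L_graph f (fun x => lambda * f x).

Definition eigenbasis (A : set (R -> R)) : Prop :=
  [/\ countable A, A `<=` eigenvector,
      forall f g, A f -> A g -> ip dx_torus f g = (f == g)%:R &
      forall g, g \in Lfun dx_torus 2%:E ->
        (forall f, A f -> ip dx_torus g f = 0) ->
        {ae dx_torus, forall x, g x = 0}].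

End one_dim.

Section W_Sobolev.
Context {R : realType} {d : nat}.
Variables (W : 'I_d -> cumulative R R) (A : 'I_d -> set (R -> R)).
Implicit Types (f g h : d.-tuple (measurableTypeR R) -> R) (x : d.-tuple (measurableTypeR R)) (i : 'I_d).

Definition slice f i x : R -> R :=
  fun u => f [tuple (if k == i then u else tnth x k) | k < d].

Definition partial_x i f x : R := derive1 (slice f i x) (tnth x i).

Definition partial_W i f x : R :=
  generalized_derivative (W i) (slice f i x) (tnth x i).

(* For f in [DW] the classical derivative in [partial_x] exists and agrees with
   the L^2 derivative of [L_graph] off countably many hyperplanes x_i = c. *)
Definition LW f x : R := \sum_(i < d) partial_x i (partial_W i f) x.

Definition AW : set (d.-tuple (measurableTypeR R) -> R) :=
  [set f | exists phi : 'I_d -> R -> R,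
    (forall k, A k (phi k)) /\ f = fun x => \prod_(k < d) phi k (tnth x k)].

Definition DW : set (d.-tuple (measurableTypeR R) -> R) :=
  [set f | exists (n : nat) (c : 'I_n -> R) (e : 'I_n -> d.-tuple (measurableTypeR R) -> R),
    (forall j, AW (e j)) /\ f = fun x => \sum_(j < n) c j * e j x].

(* G is an i-th generalized weak derivative of g.  This is a relation because
   the zero-mean condition does not determine G when d > 1: any zero-mean
   square-integrable function of the coordinates other than i can be added. *)
Definition weak_derivative i g (G : d.-tuple (measurableTypeR R) -> R) : Prop :=
  [/\ G \in Lfun (dxW W i) 2%:E, \int[dxW W i]_x G x = 0 &
      forall f, DW f ->
        ip (dx d) (partial_x i (partial_W i f)) g =
        - ip (dxW W i) (partial_W i f) G].

Definition Htilde1W : set (d.-tuple (measurableTypeR R) -> R) :=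
  [set g | g \in Lfun (dx d) 2%:E /\
           forall i, exists G, weak_derivative i g G].

(* ||g||_{1,W} for a function g with weak derivatives G i *)
Definition Sobolev_norm g (G : 'I_d -> d.-tuple (measurableTypeR R) -> R) : R :=
  Num.sqrt (ip (dx d) g g + \sum_(i < d) ip (dxW W i) (G i) (G i)).

Definition energetic_ip f g : R :=
  ip (dx d) f g + ip (dx d) (fun x => - LW f x) g.

Definition energetic_norm f : R := Num.sqrt (energetic_ip f f).

Definition H1W : set (d.-tuple (measurableTypeR R) -> R) :=
  [set f | f \in Lfun (dx d) 2%:E /\
    exists h : nat -> d.-tuple (measurableTypeR R) -> R,
      [/\ forall n, DW (h n),
          L2norm (dx d) (h n \- f) @[n --> \oo] --> 0 &
          forall e, 0 < e -> exists N, forall m n, (N <= m)%N -> (N <= n)%N ->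
            energetic_norm (h m \- h n) < e]].

End W_Sobolev.

(* Main.v *)
Require Import Defs.
From mathcomp Require Import all_boot all_order all_algebra.
From mathcomp Require Import all_classical all_reals all_analysis.
From mathcomp Require Import measurable_realfun.
From mathcomp Require Import ring lra.
Set Implicit Arguments.
Unset Strict Implicit.
Unset Printing Implicit Defensive.
Import Order.TTheory GRing.Theory Num.Theory.
Import numFieldNormedType.Exports.
Local Open Scope classical_set_scope.
Local Open Scope ring_scope.

(* Tensor products of the one-dimensional eigenvectors form a complete
   orthonormal system (e_n) of L^2(T^d), with d_(x_i) d_(W_i) e_n = mu_(n,i) e_n,
   and integration by parts gives <d_(W_i) e_n, d_(W_i) e_m> = - mu_(n,i) <e_n, e_m>
   in L^2(x^i (x) W_i).  If G_i is a weak derivative of g, testing its defining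
   identity against e_n identifies <d_(W_i) e_n, G_i> with - mu_(n,i) <e_n, g>, so
   Bessel's inequality for the orthogonal family (d_(W_i) e_n)_n shows that the
   partial sums of the expansion of g are Cauchy for the energetic norm.
   Conversely the derivatives of an energetic Cauchy sequence converge by
   completeness of L^2(x^i (x) W_i), and the identity passes to the limit. *)

(** * Square-integrable functions *)

(** The generalized derivative is a pointwise limit, so it has to be computed at every point before
    orthogonality can be discussed. For a function in the one-dimensional domain, increments are
    integrals against dV of the continuous function b + int_0^y f, and a difference quotient is an
    average of that function; periodicity moves the left quotient at 0 to the point 1. Integration
    by parts is then Fubini on the triangle 0 < y <= x, where two zero-mean conditions remove the
    boundary terms. The operator is written with integrals over (0,1] while the torus measure lives
    on [0,1): they agree on periodic functions because dV has equal atoms at 0 and 1.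

    A further obstacle is that weak derivatives are not unique when d > 1. A given G_i is therefore
    used only through its products with d_(W_i) e_n, which bound the partial sums; the weak
    derivative towards which the approximation converges is the limit of the derivatives of the
    partial sums. One sequence of coefficients <e_n, g> serves the function and all its derivatives
    at once. *)

Section ae_integral.
Context {R : realType} {disp : measure_display} {T : measurableType disp}.
Variable mu : {measure set T -> \bar R}.
Import HBNNSimple.

(** The integral of a nonnegative function is the supremum over the simple functions below it.
    Cutting such a function to 0 on the null set [N] keeps its integral and puts it below [g]. The
    purpose is to integrate [partial_x i (partial_W W i f)], which is known only up to a null
    set. *)
Let ge0_le_ae (f g : T -> \bar R) : (forall x, 0 <= f x)%E -> (forall x, 0 <= g x)%E ->
  {ae mu, forall x, f x = g x} -> (\int[mu]_x f x <= \int[mu]_x g x)%E.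
Proof.
move=> f0 g0 [N [mN N0 sub]].
rewrite ge0_integralTE//; apply: ge_ereal_sup => _ /= [h hf <-].
pose k : {nnsfun T >-> R} := proj_nnsfun h (measurableC mN).
have mE (u : {nnsfun T >-> R}) : measurable_fun setT (fun x => (u x)%:E).
  exact/measurable_EFinP.
rewrite -integralT_nnsfun.
rewrite (@ge0_ae_eq_integral _ _ _ mu setT (EFin \o h) (EFin \o k))//; last 5 first.
- exact: mE.
- exact: mE.
- by move=> x _; rewrite lee_fin.
- by move=> x _; rewrite lee_fin.
- exists N; split => // x /= hk; apply: contrapT => xN; apply: hk => _.
  by rewrite /= /mindic indicE mem_set ?mulr1.
rewrite integralT_nnsfun ge0_integralTE//.
apply: ereal_sup_ubound; exists k => // x /=.
rewrite /= /mindic indicE; case: (pselect (N x)) => xN.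
  by rewrite memNset ?mulr0//= => /(_ xN).
rewrite mem_set// mulr1; apply: (le_trans (hf x)).
suff -> : f x = g x by [].
by apply: contrapT => fg; apply: xN; exact: sub.
Qed.

(* [ae_eq_integral] of the library asks for measurable integrands. *)
Lemma eq_ae_integral (f g : T -> \bar R) :
  {ae mu, forall x, f x = g x} -> (\int[mu]_x f x = \int[mu]_x g x)%E.
Proof.
move=> fg.
have h (u v : T -> \bar R) : (forall x, 0 <= u x)%E -> (forall x, 0 <= v x)%E ->
    {ae mu, forall x, u x = v x} -> (\int[mu]_x u x = \int[mu]_x v x)%E.
  move=> u0 v0 uv; apply/eqP; rewrite eq_le; apply/andP; split; first exact: ge0_le_ae.
  by apply: ge0_le_ae => //; apply: filterS uv => x ->.
rewrite integralE [RHS]integralE; congr (_ - _)%E.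
- by apply: h => //; apply: filterS fg => x fgx; rewrite !funeposE fgx.
- by apply: h => //; apply: filterS fg => x fgx; rewrite !funenegE fgx.
Qed.

Lemma eq_ae_Rintegral (f g : T -> R) :
  {ae mu, forall x, f x = g x} -> \int[mu]_x f x = \int[mu]_x g x.
Proof.
by move=> fg; congr fine; apply: eq_ae_integral; apply: filterS fg => x ->.
Qed.

End ae_integral.

(** * The inner product of L^2 and the Cauchy-Schwarz inequality *)

Section L2.
Context {R : realType} {disp : measure_display} {T : measurableType disp}.
Variable mu : {measure set T -> \bar R}.
Implicit Types f g h : T -> R.
Local Notation L2 := (Lfun mu 2%:E).

Lemma L2_measurable f : f \in L2 -> measurable_fun setT f.
Proof. by rewrite inE => /andP[+ _]; rewrite inE. Qed.

Lemma L2_integrableM f g : f \in L2 -> g \in L2 ->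
  mu.-integrable setT (EFin \o (fun x => f x * g x)).
Proof. by move=> f2 g2; apply/Lfun1_integrable; exact: Lfun2_mul_Lfun1. Qed.

Lemma L2P f : f \in L2 <->
  measurable_fun setT f /\ (\int[mu]_x (f x ^+ 2)%:E < +oo)%E.
Proof.
split=> [f2|[mf f2]].
  split; first exact: L2_measurable.
  have /integrableP[_] := Lfun2_integrable_sqr f2.
  by under eq_integral do rewrite gee0_abs ?lee_fin ?sqr_ge0//.
rewrite inE; apply/andP; rewrite !inE/=; split => //.
rewrite /finite_norm unlock/= poweR_lty//.
by under eq_integral do rewrite powR_mulrn// real_normK ?num_real//.
Qed.

Lemma eq_L2 f g : f =1 g -> f \in L2 -> g \in L2.
Proof. by move=> /funext ->. Qed.

Lemma L2Z c f : f \in L2 -> (fun x => c * f x) \in L2.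
Proof.
move=> f2; apply: (@eq_L2 (c \o* f)); first by move=> x /=; rewrite mulrC.
by apply: Lfun_scale => //; rewrite ler1n.
Qed.

Lemma L2D f g : f \in L2 -> g \in L2 -> (fun x => f x + g x) \in L2.
Proof.
move=> f2 g2; have := (Lfun_submod_closed mu (lee1n 2)).2 1 f g f2 g2.
by apply: eq_L2 => x; rewrite /= scale1r.
Qed.

Lemma L2N f : f \in L2 -> (fun x => - f x) \in L2.
Proof. by move=> /(L2Z (-1)); apply: eq_L2 => x; rewrite mulN1r. Qed.

Lemma L2B f g : f \in L2 -> g \in L2 -> (f \- g) \in L2.
Proof. by move=> f2 /L2N g2; exact: L2D f2 g2. Qed.

Lemma L2_0 : (fun=> 0 : R) \in L2.
Proof. exact: (Lfun_submod_closed mu (lee1n 2)).1. Qed.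

Lemma L2_sum (I : Type) (s : seq I) (f : I -> T -> R) :
  (forall i, f i \in L2) -> (fun x => \sum_(i <- s) f i x) \in L2.
Proof.
move=> f2; elim: s => [|i s ih].
  by apply: eq_L2 L2_0 => x; rewrite big_nil.
by apply: eq_L2 (L2D (f2 i) ih) => x; rewrite big_cons.
Qed.

Lemma ipC f g : ip mu f g = ip mu g f.
Proof. by apply: eq_Rintegral => x _; rewrite mulrC. Qed.

Lemma eq_ip f f' g g' : f =1 f' -> g =1 g' -> ip mu f g = ip mu f' g'.
Proof. by move=> /funext -> /funext ->. Qed.

Lemma eq_ae_ip f f' g g' : {ae mu, forall x, f x = f' x} ->
  {ae mu, forall x, g x = g' x} -> ip mu f g = ip mu f' g'.
Proof.
move=> ff gg; apply: eq_ae_Rintegral.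
by apply: filterS2 ff gg => x -> ->.
Qed.

Lemma ipDl f g h : f \in L2 -> g \in L2 -> h \in L2 ->
  ip mu (fun x => f x + g x) h = ip mu f h + ip mu g h.
Proof.
move=> f2 g2 h2; rewrite /ip -RintegralD//; try exact: L2_integrableM.
by apply: eq_Rintegral => x _; rewrite mulrDl.
Qed.

Lemma ipZl c f h : f \in L2 -> h \in L2 ->
  ip mu (fun x => c * f x) h = c * ip mu f h.
Proof.
move=> f2 h2; rewrite /ip -RintegralZl//; last exact: L2_integrableM.
by apply: eq_Rintegral => x _; rewrite mulrA.
Qed.

Lemma ipNl f h : f \in L2 -> h \in L2 -> ip mu (fun x => - f x) h = - ip mu f h.
Proof.
move=> f2 h2; rewrite -mulN1r -ipZl//.
by apply: eq_ip => // x; rewrite mulN1r.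
Qed.

Lemma ipBl f g h : f \in L2 -> g \in L2 -> h \in L2 ->
  ip mu (f \- g) h = ip mu f h - ip mu g h.
Proof. by move=> f2 g2 h2; rewrite -ipNl// -ipDl//; exact: L2N. Qed.

Lemma ip0l h : ip mu (fun=> 0) h = 0.
Proof.
rewrite /ip (@eq_Rintegral _ _ _ _ _ (fun=> 0)) ?Rintegral_cst ?mul0r// => x _.
by rewrite mul0r.
Qed.

Lemma ip_suml (I : Type) (s : seq I) (f : I -> T -> R) h :
  (forall i, f i \in L2) -> h \in L2 ->
  ip mu (fun x => \sum_(i <- s) f i x) h = \sum_(i <- s) ip mu (f i) h.
Proof.
move=> f2 h2; elim: s => [|i s ih].
  rewrite big_nil -[RHS](ip0l h).
  by apply: eq_ip => // x; rewrite big_nil.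
rewrite big_cons -ih -ipDl ?L2_sum//.
by apply: eq_ip => // x; rewrite big_cons.
Qed.

Lemma ipBr f g h : f \in L2 -> g \in L2 -> h \in L2 ->
  ip mu h (f \- g) = ip mu h f - ip mu h g.
Proof. by move=> f2 g2 h2; rewrite !(ipC h) ipBl. Qed.

Lemma ipZr c f h : f \in L2 -> h \in L2 ->
  ip mu h (fun x => c * f x) = c * ip mu h f.
Proof. by move=> f2 h2; rewrite !(ipC h) ipZl. Qed.

Lemma ipDZl c f g h : f \in L2 -> g \in L2 -> h \in L2 ->
  ip mu (fun x => f x + c * g x) h = ip mu f h + c * ip mu g h.
Proof. by move=> f2 g2 h2; rewrite ipDl ?ipZl ?L2Z. Qed.

Lemma ipDZr c f g h : f \in L2 -> g \in L2 -> h \in L2 ->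
  ip mu h (fun x => f x + c * g x) = ip mu h f + c * ip mu h g.
Proof. by move=> f2 g2 h2; rewrite !(ipC h) ipDZl. Qed.

Lemma ip_sumr (I : Type) (s : seq I) (f : I -> T -> R) h :
  (forall i, f i \in L2) -> h \in L2 ->
  ip mu h (fun x => \sum_(i <- s) f i x) = \sum_(i <- s) ip mu h (f i).
Proof.
by move=> f2 h2; rewrite ipC ip_suml//; apply: eq_bigr => i _; rewrite ipC.
Qed.

Lemma ip_ge0 f : 0 <= ip mu f f.
Proof. by apply: Rintegral_ge0 => x _; rewrite -expr2 sqr_ge0. Qed.

Lemma ip_def f : f \in L2 -> ip mu f f = 0 -> {ae mu, forall x, f x = 0}.
Proof.
move=> f2 ff0.
have mf := L2_measurable f2.
have i0 : (\int[mu]_x `|(f x * f x)%:E| = 0)%E.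
  transitivity ((ip mu f f)%:E); last by rewrite ff0.
  rewrite /ip /Rintegral fineK; last first.
    by apply: integrable_fin_num => //; exact: L2_integrableM.
  by apply: eq_integral => x _; rewrite gee0_abs// lee_fin -expr2 sqr_ge0.
have : ae_eq mu setT (EFin \o (fun x => f x * f x)) (cst 0)%E.
  apply: (ae_eq_integral_abs mu measurableT _).1 => //.
  by apply/measurable_EFinP; exact: measurable_funM.
apply: filterS => x /= /(_ I) [] /eqP.
by rewrite mulf_eq0 orbb => /eqP.
Qed.

Lemma ip_sqrB f g : f \in L2 -> g \in L2 ->
  ip mu (f \- g) (f \- g) = ip mu f f - 2 * ip mu f g + ip mu g g.
Proof.
by move=> f2 g2; rewrite ipBl ?ipBr ?L2B// (ipC g f); ring.
Qed.

Lemma cauchy_schwarz f g : f \in L2 -> g \in L2 ->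
  ip mu f g ^+ 2 <= ip mu f f * ip mu g g.
Proof.
move=> f2 g2.
have h (a b : R) : 0 <= a ^+ 2 * ip mu f f - 2 * a * b * ip mu f g + b ^+ 2 * ip mu g g.
  apply: le_trans (ip_ge0 ((fun x => a * f x) \- (fun x => b * g x))) _.
  by rewrite ip_sqrB ?L2Z// !(ipZl, ipZr) ?L2Z//; lra.
have f0 := ip_ge0 f; have g0 := ip_ge0 g.
(* With these coefficients the quadratic form factors as <g,g> (<f,f> <g,g> - <f,g>^2). *)
have := h (ip mu g g) (ip mu f g).
move: g0; rewrite le_eqVlt => /predU1P[g0|g0].
  have [->|s0] := eqVneq (ip mu f g) 0; first by rewrite expr0n mulr_ge0// ip_ge0.
  (* When <g,g> = 0 the form is affine in b; this b gives it the value -1, which is absurd. *)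
  have := h 1 ((ip mu f f + 1) / (2 * ip mu f g)); rewrite -g0 => + _.
  rewrite (_ : 2 * 1 * _ * _ = ip mu f f + 1); first lra.
  by field; rewrite s0.
move=> hg; rewrite -subr_ge0 -(pmulr_rge0 _ g0); apply: (le_trans hg); lra.
Qed.

(* The triangle inequality in a weak form that avoids square roots. *)
Lemma ip_triangle f g h : f \in L2 -> g \in L2 -> h \in L2 ->
  ip mu (f \- h) (f \- h) <=
  2 * ip mu (f \- g) (f \- g) + 2 * ip mu (g \- h) (g \- h).
Proof.
move=> f2 g2 h2.
have : ip mu ((f \- g) \- (g \- h)) ((f \- g) \- (g \- h)) >= 0 by exact: ip_ge0.
rewrite !ip_sqrB ?L2B//  !(ipBl, ipBr) ?L2B//; lra.
Qed.

End L2.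

(** * Convergence and completeness in L^2, measured by squared norms *)

Section L2_convergence.
Context {R : realType} {disp : measure_display} {T : measurableType disp}.
Variable mu : {measure set T -> \bar R}.
Implicit Types f g h : T -> R.
Local Notation L2 := (Lfun mu 2%:E).

Definition L2_cauchy (u : nat -> T -> R) := forall e, 0 < e ->
  exists N, forall m n, (N <= m)%N -> (N <= n)%N ->
    ip mu (u m \- u n) (u m \- u n) < e.

Definition L2_cvg (u : nat -> T -> R) f :=
  ip mu (u n \- f) (u n \- f) @[n --> \oo] --> 0.

Lemma L2_cvgP u f : L2_cvg u f <-> forall e, 0 < e ->
  exists N, forall n, (N <= n)%N -> ip mu (u n \- f) (u n \- f) < e.
Proof.
split=> [/cvgrPdist_lt uf e /uf [N _ hN]|uf].
  by exists N => n /hN /=; rewrite sub0r normrN ger0_norm// ip_ge0.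
apply/cvgrPdist_lt => e /uf[N hN]; exists N => // n /hN /=.
by rewrite sub0r normrN ger0_norm// ip_ge0.
Qed.

Lemma ip_EFin f : f \in L2 -> (\int[mu]_x (f x ^+ 2)%:E = (ip mu f f)%:E)%E.
Proof.
move=> f2; rewrite /ip /Rintegral fineK.
  by apply: eq_integral => x _; rewrite expr2.
by apply: integrable_fin_num => //; exact: L2_integrableM.
Qed.

Lemma L2_cvg_ip u f h : (forall n, u n \in L2) -> f \in L2 -> h \in L2 ->
  L2_cvg u f -> ip mu (u n) h @[n --> \oo] --> ip mu f h.
Proof.
move=> u2 f2 h2 /L2_cvgP uf; apply/cvgrPdist_lt => e e0.
have c0 : 0 < ip mu h h + 1 by rewrite ltr_wpDl ?ip_ge0.
(* By Cauchy-Schwarz the squared error is at most <h,h> times the squared distance; the + 1 keeps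
   the denominator positive when <h,h> = 0. *)
have [|N hN] := uf (e ^+ 2 / (ip mu h h + 1)).
  by rewrite divr_gt0// exprn_gt0.
exists N => // n /hN /=; rewrite ltr_pdivlMr// => hn.
rewrite distrC -ipBl//.
have := cauchy_schwarz (L2B (u2 n) f2) h2.
have := ip_ge0 mu (u n \- f); have := ip_ge0 mu h.
move: hn; set a := ip mu _ _; set b := ip mu h h; set c := ip mu _ h => h1 h2' h3 h4.
by rewrite ltr_norml; apply/andP; split; nra.
Qed.

Lemma ip_sqrBC f g : ip mu (f \- g) (f \- g) = ip mu (g \- f) (g \- f).
Proof. by apply: eq_Rintegral => x _ /=; ring. Qed.

Lemma L2_cvg_cauchy u f : (forall n, u n \in L2) -> f \in L2 ->
  L2_cvg u f -> L2_cauchy u.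
Proof.
move=> u2 f2 /L2_cvgP uf e e0; have [|N hN] := uf (e / 4); first by rewrite divr_gt0.
exists N => m n /hN hm /hN hn; apply: le_lt_trans (ip_triangle (u2 m) f2 (u2 n)) _.
rewrite (ip_sqrBC f); lra.
Qed.

(** Fatou's lemma for (f - v_n)^2. The conclusion is an extended integral because it also serves to
    show that the pointwise limit [g] is square-integrable. *)
Lemma Fatou_L2 (v : nat -> T -> R) f g e :
  (forall n, v n \in L2) -> f \in L2 -> measurable_fun setT g -> 0 <= e ->
  {ae mu, forall x, v n x @[n --> \oo] --> g x} ->
  (exists N, forall n, (N <= n)%N -> ip mu (f \- v n) (f \- v n) <= e) ->
  (\int[mu]_x ((f x - g x) ^+ 2)%:E <= e%:E)%E.
Proof.
move=> v2 f2 mg e0 vg [N hN].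
have mf := L2_measurable f2; have mv n := L2_measurable (v2 n).
rewrite (@eq_ae_integral _ _ _ _ _
  (fun x => limn_einf (fun n => ((f x - v n x) ^+ 2)%:E))); last first.
  apply: filterS vg => x vgx; apply/esym.
  rewrite (cvg_limn_einf_sup (l := ((f x - g x) ^+ 2)%:E) _).1//.
  apply: cvg_EFin; first exact: nearW.
  rewrite (_ : fine \o _ = fun n => (f x - v n x) ^+ 2)//.
  by apply: cvgM; apply: cvgB => //; exact: cvg_cst.
apply: le_trans.
  apply: (@fatou _ _ _ mu setT measurableT (fun n x => ((f x - v n x) ^+ 2)%:E)).
    by move=> n; apply/measurable_EFinP; apply: measurable_funX; exact: measurable_funB.
  by move=> n x _; rewrite lee_fin sqr_ge0.
rewrite limn_einf_lim; apply: lime_le; first exact: is_cvg_einfs.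
exists N => // n /= Nn; apply: (@le_trans _ _ (ip mu (f \- v n) (f \- v n))%:E).
  rewrite -ip_EFin ?L2B//; apply: ereal_inf_lbound; exists n => //=.
by rewrite lee_fin hN.
Qed.

Let square_le (C a : R) : 0 <= C -> a ^+ 2 <= C -> `|a| <= C + 1.
Proof.
move=> C0 aC; by rewrite ler_norml; apply/andP; split; nra.
Qed.

(** The rate 8^-k leaves room for the weight 4^k: the weighted squares of the increments have a
    summable integral, so their sum is finite almost everywhere, and there the increments are
    dominated by a geometric sequence of ratio 1/2. *)
Lemma fast_L2_cauchy_cvg (v : nat -> T -> R) : (forall n, v n \in L2) ->
  (forall k, ip mu (v k.+1 \- v k) (v k.+1 \- v k) <= 8^-1 ^+ k) ->
  exists2 g : T -> R, measurable_fun setT g & {ae mu, forall x, v n x @[n --> \oo] --> g x}.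
Proof.
move=> v2 hv; have mv n := L2_measurable (v2 n).
pose D k x : R := v k.+1 x - v k x.
pose t k x : \bar R := (4 ^+ k * D k x ^+ 2)%:E.
pose S x := (\sum_(k <oo) t k x)%E.
have p4 k : 0 <= 4 ^+ k :> R by apply: exprn_ge0; lra.
have t0 k x : (0 <= t k x)%E by rewrite lee_fin mulr_ge0 ?p4 ?sqr_ge0.
have mt k : measurable_fun setT (t k).
  apply/measurable_EFinP; apply: measurable_funM => //.
  by apply: measurable_funX; exact: measurable_funB.
have mS : measurable_fun setT S by exact: (@ge0_emeasurable_sum _ _ _ setT t xpredT).
have Soo : (\int[mu]_x S x < +oo)%E.
  rewrite integral_nneseries//.
  apply: (@le_lt_trans _ _ (\sum_(k <oo) (2 / (2 ^ k.+1)%:R)%:E)%E); last first.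
    by apply: (le_lt_trans (epsilon_trick0 _ _)); rewrite ?ler0n ?ltry.
  apply: lee_nneseries => [k _ _|k _]; first exact: integral_ge0.
  rewrite /t; under eq_integral do rewrite EFinM.
  have mD : measurable_fun setT (fun x => (D k x ^+ 2)%:E).
    by apply/measurable_EFinP; apply: measurable_funX; exact: measurable_funB.
  rewrite ge0_integralZl ?lee_fin//; last by move=> x _; rewrite lee_fin sqr_ge0.
  rewrite ip_EFin ?L2B// -EFinM lee_fin.
  apply: (@le_trans _ _ (4 ^+ k * 8^-1 ^+ k)); first by apply: ler_wpM2l; [exact: p4|exact: hv].
  rewrite expnS natrM invfM mulrA divff// mul1r natrX -exprMn -exprVn.
  by apply: lerXn2r; rewrite ?nnegrE; lra.
have aeS : {ae mu, forall x, S x \is a fin_num}.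
  have : mu.-integrable setT S.
    apply/integrableP; split => //.
    by under eq_integral do rewrite gee0_abs ?nneseries_ge0//.
  by move=> /(integrable_ae measurableT); apply: filterS => x; exact.
have vcvg x : S x \is a fin_num -> cvgn (v^~ x).
  move=> Sx; pose C := fine (S x).
  have C0 : 0 <= C by rewrite fine_ge0// nneseries_ge0.
  have tC k : (t k x <= C%:E)%E.
    rewrite /C fineK//; apply: le_trans (nneseries_lim_ge k.+1 _) => //.
    by rewrite big_nat_recr//= leeDr// sume_ge0.
  have DC k : `|D k x| <= (C + 1) * 2^-1 ^+ k.
    have := tC k; rewrite /t lee_fin.
    have -> : 4 ^+ k * D k x ^+ 2 = (2 ^+ k * D k x) ^+ 2.
      rewrite exprMn -exprM mulnC exprM; congr (_ ^+ k * _); lra.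
    move=> /(square_le C0).
    rewrite normrM ger0_norm ?exprn_ge0// mulrC -ler_pdivlMr ?exprn_gt0//.
    by rewrite exprVn.
  have : cvgn (series (D^~ x)).
    apply: normed_cvg; apply: (series_le_cvg _ _ DC) => //.
    - by move=> k; rewrite mulr_ge0// ?addr_ge0// exprn_ge0.
    - by apply: is_cvg_geometric_series; rewrite ger0_norm//; lra.
  have -> : v^~ x = (fun n => v 0%N x + series (D^~ x) n).
    by apply/funext => n; exact: eq_sum_telescope.
  by apply: is_cvgD; exact: is_cvg_cst.
(* Setting the sequence to 0 off the measurable set where [S] is finite makes it converge
   everywhere, so its limit is measurable. *)
pose G := [set x | S x \is a fin_num].
have mG : measurable G by rewrite -[G]setTI; exact: emeasurable_fin_num.
pose w k x : R := v k x * \1_G x.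
have wcvg x : cvgn (w^~ x).
  rewrite /w indicE; case: (pselect (G x)) => Gx.
    rewrite mem_set//=; under eq_fun do rewrite mulr1.
    exact: vcvg.
  rewrite memNset//=; under eq_fun do rewrite mulr0.
  exact: is_cvg_cst.
exists (fun x => limn (w^~ x)).
  apply: (measurable_fun_cvg (h := w)) => [m|x _]; last exact: wcvg.
  by apply: measurable_funM => //; exact: measurable_indic.
apply: filterS aeS => x Sx.
suff -> : v^~ x = w^~ x by exact: wcvg.
by apply/funext => n; rewrite /w indicE mem_set ?mulr1.
Qed.

Lemma L2_complete (u : nat -> T -> R) : (forall n, u n \in L2) -> L2_cauchy u ->
  exists2 f, f \in L2 & L2_cvg u f.
Proof.
move=> u2 cu.
have c0 k : 0 < 8^-1 ^+ k :> R by rewrite exprn_gt0.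
have [N hN] := choice (fun k => cu _ (c0 k)).
(* The sum makes [phi] nondecreasing and at least [N k] at k, so both [phi k] and [phi k.+1] pass
   the threshold for 8^-k; the summand k makes [phi] unbounded. *)
pose phi k := (k + \sum_(j < k.+1) N j)%N.
have Nphi k : (N k <= phi k)%N.
  by rewrite /phi big_ord_recr/= addnA leq_addl.
have phiS k : (phi k <= phi k.+1)%N.
  by rewrite /phi [X in (_ <= _ + X)%N]big_ord_recr/= leq_add// leq_addr.
have kphi k : (k <= phi k)%N by rewrite leq_addr.
have [k|k|g mg vg] := @fast_L2_cauchy_cvg (u \o phi).
- exact: u2.
- by apply/ltW/hN; rewrite ?Nphi// (leq_trans (Nphi k)).
(* Fatou along the subsequence compares every late term of [u], not only those of the subsequence,
   with the limit. *)
have key e : 0 < e -> exists M, forall n, (M <= n)%N ->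
    (\int[mu]_x ((u n x - g x) ^+ 2)%:E <= e%:E)%E.
  move=> e0; have [M hM] := cu _ e0; exists M => n Mn.
  apply: (@Fatou_L2 (u \o phi)) => //; [by move=> k; exact: u2|exact: ltW|].
  exists M => k Mk; apply/ltW/hM => //; exact: leq_trans Mk (kphi k).
have g2 : g \in L2.
  have [M hM] := key 1 ltr01.
  have d2 : (u M \- g) \in L2.
    apply/L2P; split; first by apply: measurable_funB => //; exact: L2_measurable (u2 M).
    by apply: (le_lt_trans (hM M (leqnn _))); rewrite ltry.
  by apply: eq_L2 (L2B (u2 M) d2) => x /=; rewrite opprB addrC subrK.
exists g => //; apply/L2_cvgP => e e0; have [|M hM] := key (e / 2); first by rewrite divr_gt0.
exists M => n /hM; rewrite ip_EFin ?L2B// lee_fin => /le_lt_trans; apply; lra.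
Qed.

(** * Bessel's inequality and Fourier expansions along an orthogonal sequence *)

Section orthogonal.
Variable u : nat -> T -> R.
Hypothesis u2 : forall n, u n \in L2.
Hypothesis u_ortho : forall i j, i != j -> ip mu (u i) (u j) = 0.

Lemma ip_orthogonal_sum (c : nat -> R) m n :
  ip mu (fun x => \sum_(m <= j < n) c j * u j x) (fun x => \sum_(m <= j < n) c j * u j x) =
  \sum_(m <= j < n) c j ^+ 2 * ip mu (u j) (u j).
Proof.
have cu2 j : (fun x => c j * u j x) \in L2 by exact: L2Z.
rewrite ip_suml ?L2_sum//; apply: eq_big_nat => j mjn.
rewrite ip_sumr// (bigD1_seq j) ?mem_index_iota ?iota_uniq//=.
rewrite big1 => [|i ij]; last by rewrite ipZl ?L2Z// ipZr// u_ortho ?mulr0// eq_sym.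
by rewrite addr0 ipZl// ipZr// mulrA expr2.
Qed.

(* [c j] is the Fourier coefficient of [G] along [u j], stated without division
   since [u j] may vanish. *)
Lemma bessel_cauchy (c : nat -> R) (G : T -> R) : G \in L2 ->
  (forall j, ip mu (u j) G = c j * ip mu (u j) (u j)) ->
  L2_cauchy (fun n x => \sum_(0 <= j < n) c j * u j x).
Proof.
move=> G2 uG; have cu2 j : (fun x => c j * u j x) \in L2 by exact: L2Z.
pose s n := \sum_(0 <= j < n) c j ^+ 2 * ip mu (u j) (u j).
(* Bessel's inequality: the squared distance from [G] to the n-th partial sum is <G,G> - s n. *)
have sG n : s n <= ip mu G G.
  have := ip_ge0 mu (G \- (fun x => \sum_(0 <= j < n) c j * u j x)).
  rewrite ip_sqrB ?L2_sum// ip_orthogonal_sum (ipC _ G) ip_suml//.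
  under eq_bigr do rewrite ipZl// uG mulrA -expr2.
  by rewrite -/(s n); lra.
have nds : nondecreasing_seq s.
  apply/nondecreasing_seqP => n; rewrite /s [leRHS]big_nat_recr//= lerDl.
  by rewrite mulr_ge0 ?sqr_ge0 ?ip_ge0.
have cs : cvgn s.
  apply: nondecreasing_is_cvgn => //.
  by exists (ip mu G G) => _ [n _ <-]; exact: sG.
move=> e e0; have e20 : 0 < e / 2 by rewrite divr_gt0.
move/cvgrPdist_lt : cs => /(_ _ e20)[N _ hN]; exists N.
suff H m n : (N <= m)%N -> (m <= n)%N ->
    ip mu ((fun x => \sum_(0 <= j < n) c j * u j x) \- (fun x => \sum_(0 <= j < m) c j * u j x))
          ((fun x => \sum_(0 <= j < n) c j * u j x) \- (fun x => \sum_(0 <= j < m) c j * u j x)) < e.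
  move=> m n Nm Nn; have [mn|/ltnW nm] := leqP m n; last exact: H.
  by rewrite ip_sqrBC; exact: H.
move=> Nm mn.
rewrite (@eq_ip _ _ _ _ _ (fun x => \sum_(m <= j < n) c j * u j x)
  _ (fun x => \sum_(m <= j < n) c j * u j x)); last 2 first.
- by move=> x; exact: (sub_series_geq (fun j => c j * u j x) mn).
- by move=> x; exact: (sub_series_geq (fun j => c j * u j x) mn).
rewrite ip_orthogonal_sum.
have -> : \sum_(m <= j < n) c j ^+ 2 * ip mu (u j) (u j) = s n - s m.
  by rewrite -(sub_series_geq (fun j => c j ^+ 2 * ip mu (u j) (u j)) mn).
have := hN m Nm; have := hN n (leq_trans Nm mn); rewrite /= !ltr_norml.
by move=> /andP[? ?] /andP[? ?]; lra.
Qed.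

(** Bessel and completeness give the partial sums some limit [g]; it has the same products with
    every [u j] as [G], so totality identifies the two almost everywhere. *)
Lemma fourier_cvg (c : nat -> R) (G : T -> R) : G \in L2 ->
  (forall j, ip mu (u j) G = c j * ip mu (u j) (u j)) ->
  (forall h, h \in L2 -> (forall j, ip mu (u j) h = 0) -> {ae mu, forall x, h x = 0}) ->
  L2_cvg (fun n x => \sum_(0 <= j < n) c j * u j x) G.
Proof.
move=> G2 uG total.
have cu2 j : (fun x => c j * u j x) \in L2 by exact: L2Z.
have S2 n : (fun x => \sum_(0 <= j < n) c j * u j x) \in L2 by exact: L2_sum.
have [g g2 Sg] := L2_complete S2 (bessel_cauchy G2 uG).
have ug j : ip mu (u j) g = ip mu (u j) G.
  rewrite uG ipC.
  apply: (@cvg_unique _ (@Rhausdorff R) _ _ _ _ (L2_cvg_ip S2 g2 (u2 j) Sg)).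
  (* The product of the n-th partial sum with [u j] no longer changes once n > j. *)
  apply: cvg_near_cst; exists j.+1 => // n /= jn.
  rewrite ip_suml// (bigD1_seq j) ?mem_index_iota ?iota_uniq//= big1 => [|i ij].
    by rewrite addr0 ipZl.
  by rewrite ipZl// u_ortho ?mulr0// eq_sym.
have : {ae mu, forall x, (G \- g) x = 0}.
  by apply: total => [|j]; [exact: L2B|rewrite ipBr// ug subrr].
rewrite /L2_cvg => Gg.
rewrite (_ : (fun n => _) = (fun n => ip mu ((fun x => \sum_(0 <= j < n) c j * u j x) \- g)
   ((fun x => \sum_(0 <= j < n) c j * u j x) \- g)))//.
apply/funext => n; apply: eq_ae_ip; apply: filterS Gg => x /= /eqP;
  by rewrite subr_eq0 => /eqP ->.
Qed.

End orthogonal.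
End L2_convergence.

(** * Product measures *)

Section product_of_two.
Context {R : realType} {d1 d2 : measure_display}.
Context {T1 : measurableType d1} {T2 : measurableType d2}.
Variables (m1 : {finite_measure set T1 -> \bar R}) (m2 : {finite_measure set T2 -> \bar R}).

Lemma integrable_tensor (f : T1 -> R) (g : T2 -> R) :
  m1.-integrable setT (EFin \o f) -> m2.-integrable setT (EFin \o g) ->
  (m1 \x m2)%E.-integrable setT (fun z => (f z.1 * g z.2)%:E).
Proof.
move=> if_ ig.
have mf : measurable_fun setT f by apply/measurable_EFinP; exact: measurable_int if_.
have mg : measurable_fun setT g by apply/measurable_EFinP; exact: measurable_int ig.
apply/integrable12ltyP.
  by apply/measurable_EFinP; apply: measurable_funM; exact: measurableT_comp.
under eq_integral => x _.
  under eq_integral do rewrite /= normrM EFinM.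
  rewrite ge0_integralZl//; last by do 2 apply: measurableT_comp.
  over.
rewrite /= ge0_integralZr//; last 2 first.
- by do 2 apply: measurableT_comp.
- exact: integral_ge0.
have /integrableP[_ f_lty] := if_; have /integrableP[_ g_lty] := ig.
by apply: lte_mul_pinfty => //; [exact: integral_ge0|rewrite ge0_fin_numE// integral_ge0].
Qed.

Lemma Rintegral_tensor (f : T1 -> R) (g : T2 -> R) :
  m1.-integrable setT (EFin \o f) -> m2.-integrable setT (EFin \o g) ->
  \int[(m1 \x m2)%E]_z (f z.1 * g z.2) = (\int[m1]_x f x) * (\int[m2]_y g y).
Proof.
move=> if_ ig; rewrite /Rintegral -integral12_prod_meas1; last exact: integrable_tensor.
rewrite /fubini_F/=.
under eq_integral => x _.
  under eq_integral do rewrite /= EFinM.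
  rewrite integralZl// -[X in (_ * X)%E]fineK; last exact: integrable_fin_num.
  over.
by rewrite integralZr// fineM//; exact: integrable_fin_num.
Qed.

End product_of_two.

Section tuple_measure.
Context {R : realType} {disp : measure_display} {T : measurableType disp}.

Section cons.
Context {n : nat} (m1 : {finite_measure set T -> \bar R})
  (m2 : {finite_measure set (n.-tuple T) -> \bar R}).

Lemma measurable_consf :
  measurable_fun setT (fun p : T * n.-tuple T => [tuple of p.1 :: p.2]).
Proof. exact: measurable_cons. Qed.

Lemma integrable_cons (f : n.+1.-tuple T -> R) : measurable_fun setT f ->
  (m1 \x m2)%E.-integrable setT (fun z => (f [tuple of z.1 :: z.2])%:E) ->
  (cons_measure m1 m2).-integrable setT (EFin \o f).
Proof.
move=> mf intf; apply: (integrable_pushforward measurable_consf) => //.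
exact/measurable_EFinP.
Qed.

Lemma Rintegral_cons (f : n.+1.-tuple T -> R) : measurable_fun setT f ->
  (m1 \x m2)%E.-integrable setT (fun z => (f [tuple of z.1 :: z.2])%:E) ->
  \int[cons_measure m1 m2]_x f x = \int[(m1 \x m2)%E]_z f [tuple of z.1 :: z.2].
Proof.
move=> mf intf; rewrite /Rintegral; congr fine.
rewrite (integral_pushforward measurable_consf)//.
exact/measurable_EFinP.
Qed.

Lemma ge0_integral_cons (f : n.+1.-tuple T -> \bar R) : measurable_fun setT f ->
  (forall x, (0 <= f x)%E) ->
  (\int[cons_measure m1 m2]_x f x = \int[m1 \x m2]_z f [tuple of z.1 :: z.2])%E.
Proof.
by move=> mf f0; rewrite (ge0_integral_pushforward measurable_consf).
Qed.
End cons.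

Definition tensor n (F : 'I_n -> T -> R) : n.-tuple T -> R :=
  fun x => \prod_(k < n) F k (tnth x k).

Lemma tensor_cons n (F : 'I_n.+1 -> T -> R) x (t : n.-tuple T) :
  tensor F [tuple of x :: t] = F ord0 x * tensor (fun k => F (lift ord0 k)) t.
Proof.
rewrite /tensor big_ord_recl tnth0; congr (_ * _).
by apply: eq_bigr => k _; rewrite tnthS.
Qed.

Lemma measurable_tensor n (F : 'I_n -> T -> R) :
  (forall k, measurable_fun setT (F k)) -> measurable_fun setT (tensor F).
Proof.
move=> mF; rewrite /tensor.
elim: (index_enum _) => [|k s ih].
  by under eq_fun do rewrite big_nil; exact: measurable_cst.
under eq_fun do rewrite big_cons.
apply: measurable_funM => //.
exact: (measurableT_comp (mF k) (measurable_tnth k)).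
Qed.

(** Integrability and value are proved in one induction, since Fubini for the head and the tail
    needs the tail to be integrable. *)
Lemma integral_tensor n (mu : 'I_n -> {finite_measure set T -> \bar R})
    (F : 'I_n -> T -> R) :
  (forall k, (mu k).-integrable setT (EFin \o F k)) ->
  (tuple_measure mu).-integrable setT (EFin \o tensor F) /\
  \int[tuple_measure mu]_x tensor F x = \prod_(k < n) \int[mu k]_x F k x.
Proof.
elim: n mu F => [|n ih] mu F iF.
  have -> : tensor F = cst 1 by apply/funext => x; rewrite /tensor big_ord0.
  split; first exact: finite_measure_integrable_cst.
  rewrite Rintegral_cst// big_ord0 mul1r [X in fine X](_ : _ = 1%E)//.
  exact: diracT.
have [i2 E2] := ih (fun k => mu (lift ord0 k)) (fun k => F (lift ord0 k)) (fun k => iF _).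
have mF k : measurable_fun setT (F k) by apply/measurable_EFinP; exact: measurable_int (iF k).
have i12 := integrable_tensor (iF ord0) i2.
have iz : (mu ord0 \x tuple_measure (fun k => mu (lift ord0 k)))%E.-integrable setT
    (fun z => (tensor F [tuple of z.1 :: z.2])%:E).
  by apply: eq_integrable i12 => // z _; rewrite tensor_cons.
split; first exact: (integrable_cons (measurable_tensor mF)).
rewrite (Rintegral_cons (measurable_tensor mF))//.
under eq_Rintegral do rewrite tensor_cons.
by rewrite Rintegral_tensor// E2 big_ord_recl.
Qed.

Section fixed_measures.
Variables (n : nat) (mu : 'I_n -> {finite_measure set T -> \bar R}).

Lemma L2_tensor (F : 'I_n -> T -> R) : (forall k, F k \in Lfun (mu k) 2%:E) ->
  tensor F \in Lfun (tuple_measure mu) 2%:E.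
Proof.
move=> F2; apply/L2P; split.
  by apply: measurable_tensor => k; exact: L2_measurable (F2 k).
have [/integrableP[_ +] _] := @integral_tensor n mu (fun k x => F k x ^+ 2)
  (fun k => Lfun2_integrable_sqr (F2 k)).
congr (_ < _)%E; apply: eq_integral => x _; rewrite /= ger0_norm.
  by rewrite /tensor prodrXl.
by apply: prodr_ge0 => k _; exact: sqr_ge0.
Qed.

Lemma ip_tensor (F G : 'I_n -> T -> R) :
  (forall k, F k \in Lfun (mu k) 2%:E) -> (forall k, G k \in Lfun (mu k) 2%:E) ->
  ip (tuple_measure mu) (tensor F) (tensor G) = \prod_(k < n) ip (mu k) (F k) (G k).
Proof.
move=> F2 G2.
have [_ <-] := @integral_tensor n mu (fun k x => F k x * G k x)
  (fun k => L2_integrableM (F2 k) (G2 k)).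
by apply: eq_Rintegral => x _; rewrite /tensor -big_split.
Qed.

Lemma ae_tnth i (P : T -> Prop) : {ae mu i, forall u, P u} ->
  {ae tuple_measure mu, forall x, P (tnth x i)}.
Proof.
move=> [N [mN N0 sub]].
have mNi : measurable [set x : n.-tuple T | N (tnth x i)].
  by rewrite -[X in measurable X]setTI; exact: measurable_tnth.
exists [set x | N (tnth x i)]; split => //; last by move=> x /= /sub.
pose F k : T -> R := if k == i then \1_N else cst 1.
have iF k : (mu k).-integrable setT (EFin \o F k).
  rewrite /F; case: eqP => _; last exact: finite_measure_integrable_cst.
  by apply: integrable_indic.
have [i1 E1] := integral_tensor iF.
have TF : tensor F = \1_[set x : n.-tuple T | N (tnth x i)].
  apply/funext => x; rewrite /tensor (bigD1 i)//= big1 => [|k ki].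
    by rewrite /F eqxx mulr1 !indicE; congr (_%:R); apply/idP/idP; rewrite !inE.
  by rewrite /F (negbTE ki).
have F0 : \int[mu i]_x F i x = 0.
  transitivity (fine (mu i N)); last by rewrite [X in fine X]N0.
  by rewrite /F eqxx /Rintegral integral_indic// setIT.
move: E1; rewrite TF (bigD1 i)//= F0 mul0r /Rintegral integral_indic// setIT.
by move=> /eqP; rewrite fine_eq0 ?fin_num_measure// => /eqP.
Qed.
End fixed_measures.
End tuple_measure.

(** * Totality of tensor products *)

Definition L2_total {R : realType} {disp : measure_display} {T : measurableType disp}
    (mu : {measure set T -> \bar R}) (J : Type) (E : J -> T -> R) :=
  forall h, h \in Lfun mu 2%:E -> (forall j, ip mu (E j) h = 0) ->
    {ae mu, forall x, h x = 0}.

Lemma ae_countable {R : realType} {disp : measure_display} {T : measurableType disp}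
    (mu : {measure set T -> \bar R}) (J : countType) (P : J -> T -> Prop) :
  (forall j, {ae mu, forall x, P j x}) -> {ae mu, forall x, forall j, P j x}.
Proof.
move=> aeP.
have : {ae mu, forall x, forall n, if unpickle n is Some j then P j x else True}.
  apply: ae_foralln => n; case: unpickle => [j|]; [exact: aeP|exact: aeW].
by apply: filterS => x h j; have := h (pickle j); rewrite pickleK.
Qed.

Section total_product.
Context {R : realType} {d1 d2 : measure_display}.
Context {T1 : measurableType d1} {T2 : measurableType d2}.
Variables (m1 : {finite_measure set T1 -> \bar R}) (m2 : {finite_measure set T2 -> \bar R}).
Local Notation m12 := (m1 \x m2)%E.

Lemma L2_tensor2 (f : T1 -> R) (g : T2 -> R) : f \in Lfun m1 2%:E -> g \in Lfun m2 2%:E ->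
  (fun z => f z.1 * g z.2) \in Lfun m12 2%:E.
Proof.
move=> f2 g2; apply/L2P; split.
  by apply: measurable_funM; apply: measurableT_comp => //;
    [exact: L2_measurable f2|exact: L2_measurable g2].
have /integrableP[_] := integrable_tensor (Lfun2_integrable_sqr f2) (Lfun2_integrable_sqr g2).
congr (_ < _)%E; apply: eq_integral => z _.
rewrite gee0_abs; first by rewrite exprMn.
by rewrite lee_fin; apply: mulr_ge0; exact: sqr_ge0.
Qed.

Lemma L2_sections (F : T1 * T2 -> R) : F \in Lfun m12 2%:E ->
  {ae m1, forall x, (fun y => F (x, y)) \in Lfun m2 2%:E}.
Proof.
move=> F2; have mF := L2_measurable F2.
apply: filterS (ae_integrable1 (Lfun2_integrable_sqr F2)) => x /integrableP[_ Fx].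
apply/L2P; split; first exact: measurableT_comp.
move: Fx; congr (_ < _)%E; apply: eq_integral => y _.
by rewrite /= ger0_norm// sqr_ge0.
Qed.

Section slices.
Variables (F : T1 * T2 -> R) (e : T2 -> R).
Hypotheses (F2 : F \in Lfun m12 2%:E) (e2 : e \in Lfun m2 2%:E).

Let cst2 : (fun=> 1 : R) \in Lfun m1 2%:E. Proof. exact: Lfun_cst. Qed.

Let eF_int : m12.-integrable setT (EFin \o (fun z => (1 * e z.2) * F z)).
Proof. exact: L2_integrableM (L2_tensor2 cst2 e2) F2. Qed.

(** Cauchy-Schwarz in y bounds the square of the coefficient at x by <e,e> times the integral of
    F(x,.)^2, which is integrable in x by Tonelli. *)
Lemma L2_slice : (fun x => ip m2 e (fun y => F (x, y))) \in Lfun m1 2%:E.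
Proof.
have mG : measurable_fun setT (fun x => ip m2 e (fun y => F (x, y))).
  have := measurable_fubini_F eF_int.
  move=> /(measurableT_comp (fine_measurable measurableT)).
  rewrite (_ : _ \o _ = fun x => ip m2 e (fun y => F (x, y)))//.
  by apply/funext => x; apply: eq_Rintegral => y _ /=; rewrite mul1r.
apply/L2P; split => //.
have [_ Flty] := (L2P _ _).1 F2.
have mF2 : measurable_fun setT (fun z => (F z ^+ 2)%:E).
  by apply/measurable_EFinP; apply: measurable_funX; exact: L2_measurable F2.
have mFF : measurable_fun setT (fun x => \int[m2]_y (F (x, y) ^+ 2)%:E)%E.
  by apply: (measurable_fun_fubini_tonelli_F (fun z => (F z ^+ 2)%:E)) => // z;
    rewrite lee_fin sqr_ge0.
have FF0 x : (0 <= \int[m2]_y (F (x, y) ^+ 2)%:E)%E.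
  by apply: integral_ge0 => y _; rewrite lee_fin sqr_ge0.
apply: (@le_lt_trans _ _ (\int[m1]_x ((ip m2 e e)%:E * \int[m2]_y (F (x, y) ^+ 2)%:E))%E).
  apply: ae_ge0_le_integral => //.
  - by move=> x _; rewrite lee_fin sqr_ge0.
  - by apply/measurable_EFinP; exact: measurable_funX.
  - by move=> x _; rewrite mule_ge0// lee_fin ip_ge0.
  - exact: measurable_funeM.
  - apply: filterS (L2_sections F2) => x Fx _.
    by rewrite ip_EFin// -EFinM lee_fin cauchy_schwarz.
rewrite ge0_integralZl//; last by rewrite lee_fin ip_ge0.
rewrite lte_mul_pinfty ?lee_fin ?ip_ge0//.
rewrite -(fubini_tonelli1 (fun z => (F z ^+ 2)%:E))// => z.
by rewrite lee_fin sqr_ge0.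
Qed.

Lemma ip_slice f : f \in Lfun m1 2%:E ->
  ip m1 f (fun x => ip m2 e (fun y => F (x, y))) = ip m12 (fun z => f z.1 * e z.2) F.
Proof.
move=> f2; rewrite [RHS]/ip /Rintegral -integral12_prod_meas1; last first.
  exact: L2_integrableM (L2_tensor2 f2 e2) F2.
congr fine; apply: eq_ae_integral; apply: filterS (L2_sections F2) => x Fx.
rewrite EFinM /fubini_F/= /ip /Rintegral fineK; last first.
  by apply: integrable_fin_num => //; exact: L2_integrableM.
rewrite -integralZl//; last exact: L2_integrableM.
by apply: eq_integral => y _; rewrite -EFinM mulrA.
Qed.
End slices.

(** For fixed j, the coefficient of F(x,.) along [E2 j] is a function of x orthogonal to every
    [E1 i], hence null. Countability of [J] collects the exceptional sets into one null set, off
    which totality of [E2] makes the sections vanish. *)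
Lemma total_tensor2 (I J : countType) (E1 : I -> T1 -> R) (E2 : J -> T2 -> R) :
  (forall i, E1 i \in Lfun m1 2%:E) -> (forall j, E2 j \in Lfun m2 2%:E) ->
  L2_total m1 E1 -> L2_total m2 E2 ->
  L2_total m12 (fun ij : I * J => fun z => E1 ij.1 z.1 * E2 ij.2 z.2).
Proof.
move=> E12 E22 tot1 tot2 F F2 FE.
have slice0 : {ae m1, forall x j, ip m2 (E2 j) (fun y => F (x, y)) = 0}.
  apply: ae_countable => j; apply: tot1 => [|i]; first exact: L2_slice.
  by rewrite ip_slice//; exact: (FE (i, j)).
apply: ip_def => //; rewrite /ip /Rintegral.
rewrite -integral12_prod_meas1; last exact: L2_integrableM.
rewrite (@eq_ae_integral _ _ _ _ _ (cst 0%E)) ?integral0//.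
apply: filterS2 (L2_sections F2) slice0 => x Fx Fx0.
rewrite /fubini_F (@eq_ae_integral _ _ _ _ _ (cst 0%E)) ?integral0//.
by apply: filterS (tot2 _ Fx Fx0) => y /= ->; rewrite mulr0.
Qed.

End total_product.

Section total_tuple.
Context {R : realType} {disp : measure_display} {T : measurableType disp}.

Lemma total_tensor n (mu : 'I_n -> {finite_measure set T -> \bar R})
    (J : countType) (E : 'I_n -> J -> T -> R) :
  (forall k j, E k j \in Lfun (mu k) 2%:E) -> (forall k, L2_total (mu k) (E k)) ->
  L2_total (tuple_measure mu) (fun a : {ffun 'I_n -> J} => tensor (fun k => E k (a k))).
Proof.
elim: n mu E => [|n ih] mu E E2 tot F F2 FE.
  (* On the one-point space of 0-tuples the empty product is 1, so orthogonality to it says that [F]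
     vanishes. *)
  apply: aeW => x; have := FE (ffun0 (card_ord 0)).
  rewrite /ip (@eq_Rintegral _ _ _ _ _ (fun=> F x)) => [|y _].
    rewrite Rintegral_cst// [X in fine X](_ : _ = 1%E) ?mulr1//; exact: diracT.
  by rewrite /tensor big_ord0 mul1r (tuple0 x) (tuple0 y).
pose m1 := mu ord0; pose m2 := tuple_measure (fun k => mu (lift ord0 k)).
have mF := L2_measurable F2.
pose F' (z : T * n.-tuple T) := F [tuple of z.1 :: z.2].
have F'2 : F' \in Lfun (m1 \x m2)%E 2%:E.
  apply/L2P; split; first exact: (measurableT_comp mF measurable_consf).
  have [_] := (L2P _ _).1 F2.
  rewrite (@ge0_integral_cons _ _ _ _ _ _ (fun x => (F x ^+ 2)%:E))//.
  - by apply/measurable_EFinP; exact: measurable_funX.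
  - by move=> x; rewrite lee_fin sqr_ge0.
have E2' (a : {ffun 'I_n -> J}) : tensor (fun k => E (lift ord0 k) (a k)) \in Lfun m2 2%:E.
  by apply: L2_tensor => k; exact: E2.
have F'0 : {ae (m1 \x m2)%E, forall z, F' z = 0}.
  apply: (total_tensor2 (E2 ord0) E2' (tot ord0) _ F'2) => [|[j a]].
    by apply: (ih (fun k => mu (lift ord0 k)) (fun k => E (lift ord0 k))).
  pose b : {ffun 'I_n.+1 -> J} := [ffun k => if unlift ord0 k is Some l then a l else j].
  have b0 : b ord0 = j by rewrite ffunE unlift_none.
  have bS k : b (lift ord0 k) = a k by rewrite ffunE liftK.
  have tb (z : T * n.-tuple T) : tensor (fun k => E k (b k)) [tuple of z.1 :: z.2] =
      E ord0 j z.1 * tensor (fun k => E (lift ord0 k) (a k)) z.2.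
    by rewrite tensor_cons b0; congr (_ * _); apply: eq_bigr => k _; rewrite bS.
  rewrite -[RHS](FE b) [RHS]/ip [RHS]Rintegral_cons.
  - by apply: eq_Rintegral => z _; rewrite tb.
  - apply: measurable_funM => //; apply: measurable_tensor => k.
    exact: L2_measurable (E2 k (b k)).
  - have := L2_integrableM (L2_tensor2 (E2 ord0 j) (E2' a)) F'2.
    by apply: eq_integrable => // z _; rewrite /= tb.
apply: ip_def => //; rewrite [LHS]/ip [LHS]Rintegral_cons.
- rewrite (@eq_ae_Rintegral _ _ _ _ _ (cst 0)); first by rewrite Rintegral_cst// mul0r.
  by apply: filterS F'0 => z /=; rewrite /F' => ->; rewrite mulr0.
- exact: measurable_funM.
- exact: (L2_integrableM F'2 F'2).
Qed.
End total_tuple.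

(** * The one-dimensional operator *)

Section torus_measure.
Context {R : realType}.
Implicit Types (V : cumulative R R) (f : R -> R).
Local Notation T := (measurableTypeR R).
Local Notation D := (`[0%R, 1%R[%classic : set R).

Lemma measurable_torus_itv : measurable (D : set T).
Proof. exact: measurable_itv. Qed.

Lemma dW_torusD V (A : set T) : measurable A -> A `<=` D ->
  dW_torus V A = lebesgue_stieltjes_measure V A.
Proof. by move=> mA AD; rewrite /dW_torus/= /mfrestr /mrestr setIidl. Qed.

Lemma dW_torusC V : dW_torus V (~` D : set T) = 0%E.
Proof. by rewrite /dW_torus/= /mfrestr /mrestr setICl measure0. Qed.

Lemma ae_torusP V (P : R -> Prop) :
  {ae lebesgue_stieltjes_measure V, forall x, D x -> P x} ->
  {ae dW_torus V, forall x, P x}.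
Proof.
move=> [N [mN N0 sub]].
have mND : measurable (N `&` D : set T).
  by apply: measurableI => //; exact: measurable_torus_itv.
apply: (@negligibleS _ _ _ _ ((N `&` D) `|` ~` D)).
  move=> x /= Px; case: (pselect (D x)) => Dx; last by right.
  by left; split => //; apply: sub => /= h; apply: Px; exact: h.
apply: negligibleU; apply/negligibleP => //.
- transitivity (lebesgue_stieltjes_measure V (N `&` D)).
    by apply: dW_torusD => // x [].
  apply/eqP; rewrite -measure_le0 -[leRHS]N0.
  by apply: le_measure; rewrite ?inE.
- by apply: measurableC; exact: measurable_torus_itv.
- exact: dW_torusC.
Qed.

Lemma ae_torus_in V (P : R -> Prop) : (forall x, 0 <= x < 1 -> P x) ->
  {ae dW_torus V, forall x, P x}.
Proof.
by move=> h; apply: ae_torusP; apply: aeW => x /=; rewrite in_itv/=; exact: h.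
Qed.

Lemma integral_torus V (f : T -> \bar R) :
  (\int[dW_torus V]_x f x = \int[lebesgue_stieltjes_measure V]_(x in D) f x)%E.
Proof.
transitivity (\int[dW_torus V]_x (f \_ D) x)%E.
  apply: eq_ae_integral; apply: ae_torus_in => x x01.
  by rewrite patchE mem_set//= in_itv.
rewrite -integral_mkcond; apply: eq_measure_integral => A mA AD.
exact: dW_torusD.
Qed.

Lemma Rintegral_torus V f :
  \int[dW_torus V]_x f x = \int[lebesgue_stieltjes_measure V]_(x in D) f x.
Proof. by rewrite /Rintegral integral_torus. Qed.

Lemma integrable_torus V (f : T -> \bar R) : (dW_torus V).-integrable setT f ->
  (lebesgue_stieltjes_measure V).-integrable (D : set T) f.
Proof.
move=> /integrableP[mf]; rewrite integral_torus => fy.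
by apply/integrableP; split => //; exact: measurable_funS mf.
Qed.

Lemma lebesgue_stieltjes_ocitv V a b : a <= b ->
  lebesgue_stieltjes_measure V (`]a, b] : set T) = (V b - V a)%:E.
Proof.
move=> ab; rewrite /lebesgue_stieltjes_measure /measure_extension/=.
rewrite measurable_mu_extE/=; last exact: is_ocitv.
rewrite wlength_itv/= lte_fin; move: ab; rewrite le_eqVlt => /predU1P[->|->].
  by rewrite ltxx subrr.
by rewrite EFinB.
Qed.

End torus_measure.

(** * Primitives of square-integrable functions with zero mean *)

Section primitive.
Context {R : realType}.
Local Notation T := (measurableTypeR R).
Local Notation leb := (@lebesgue_measure R).
Local Notation D := (`[0%R, 1%R[%classic : set R).
Variable f : R -> R.
Hypothesis f2 : f \in Lfun (@dx_torus R) 2%:E.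
Hypothesis f0 : \int[@dx_torus R]_x f x = 0.

Lemma L2_torus_integrable : leb.-integrable D (EFin \o f).
Proof.
apply: (@integrable_torus _ idfun); apply/Lfun1_integrable.
by apply: Lfun_subset12 f2; exact: fin_num_measure.
Qed.

Let f1 := f \_ D.

Let f1_int (A : set T) : measurable A -> leb.-integrable A (EFin \o f1).
Proof.
move=> mA; apply: (@integrableS _ _ _ _ setT) => //.
have := (integrable_mkcond _ measurable_torus_itv).1 L2_torus_integrable.
by apply: eq_integrable => // x _; rewrite restrict_EFin.
Qed.

(** On [0,1] this is int_0^y f. Cutting [f] to [0,1) and starting at -1 makes 0 an interior point,
    so that continuity there is two-sided. *)
Definition primitive (y : R) : R := \int[leb]_(x in `[-1, y]) (f \_ D) x.

Lemma continuous_primitive (u : R) : -1 < u -> primitive x @[x --> u] --> primitive u.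
Proof.
move=> u1; have u1' : -1 <= u + 1 by lra.
have := @parameterized_integral_continuous _ (-1) (u + 1) f1 u1' (f1_int _).
move=> /(_ (measurable_itv _)) /continuous_within_itvP[|c _ _]; first lra.
by apply: c; rewrite in_itv/= u1 ltrDl ltr01.
Qed.

Lemma measurable_primitive : measurable_fun (`[0, 1]%classic : set R) primitive.
Proof.
have le12 : -1 <= 2 :> R by lra.
have := @parameterized_integral_continuous _ (-1) 2 f1 le12 (f1_int _).
move=> /(_ (measurable_itv _)) c.
apply: (@measurable_funS _ _ _ _ (`[-1, 2]%classic : set R)).
- exact: measurable_itv.
- by move=> x /=; rewrite !in_itv/= => /andP[? ?]; apply/andP; split; lra.
- by apply: subspace_continuous_measurable_fun => //; exact: measurable_itv.
Qed.

Lemma primitive_bounded : exists2 M, 0 <= M & forall y, `|primitive y| <= M.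
Proof.
exists (\int[leb]_x `|f1 x|); first exact: Rintegral_ge0.
move=> y; apply: (le_trans (le_normr_Rintegral _ _)) => //.
  by apply: f1_int; exact: measurable_itv.
rewrite -lee_fin /Rintegral !fineK.
- apply: ge0_subset_integral => //.
  have := f1_int measurableT => /integrable_norm.
  by move=> /measurable_int.
- by apply: integrable_fin_num => //; apply: integrable_norm; exact: f1_int.
- apply: integrable_fin_num; first exact: measurable_itv.
  by apply: integrable_norm; apply: f1_int; exact: measurable_itv.
Qed.

Lemma primitive_co y : 0 <= y <= 1 -> primitive y = \int[leb]_(x in `[0, y[) f x.
Proof.
move=> /andP[y0 y1].
have -> : primitive y = \int[leb]_(x in `[-1, y[) f1 x.
  by rewrite [RHS]Rintegral_itv_bndo_bndc//; apply: f1_int; exact: measurable_itv.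
rewrite -Rintegral_mkcondr; congr (Rintegral _ _ _).
apply/seteqP; split => x /=; rewrite !in_itv/=.
  by move=> [/andP[? ?] /andP[? ?]]; apply/andP; split; lra.
by move=> /andP[? ?]; split; apply/andP; split; lra.
Qed.

Let f_int_co y : y <= 1 -> leb.-integrable (`[0, y[%classic : set R) (EFin \o f).
Proof.
move=> y1; apply: integrableS L2_torus_integrable; try exact: measurable_itv.
by move=> x /=; rewrite !in_itv/= => /andP[? ?]; apply/andP; split; lra.
Qed.

Lemma primitiveE y : 0 <= y <= 1 -> \int[leb]_(x in `[0, y]) f x = primitive y.
Proof.
move=> /[dup] y01 /andP[y0 y1]; rewrite primitive_co// Rintegral_itv_bndo_bndc//.
exact: f_int_co.
Qed.

Lemma primitive0 : primitive 0 = 0.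
Proof. by rewrite -primitiveE ?lexx ?ler01// set_itv1 Rintegral_set1. Qed.

(** The zero mean of [f] lets the primitive close up into a continuous function on the circle. *)
Lemma primitive1 : primitive 1 = 0.
Proof. by rewrite primitive_co ?lexx ?ler01// -[RHS]f0 Rintegral_torus. Qed.

Lemma primitive_tail y : 0 <= y < 1 -> \int[leb]_(x in `[y, 1[) f x = - primitive y.
Proof.
move=> /andP[y0 y1]; rewrite -primitiveE ?y0 ?ltW//.
rewrite -[RHS]add0r -{1}primitive1 primitive_co ?lexx ?ler01// Rintegral_itvB ?bnd_simp//.
- rewrite Rintegral_itv_obnd_cbnd//.
  apply: integrableS L2_torus_integrable; try exact: measurable_itv.
  by move=> x /=; rewrite !in_itv/= => /andP[? ?]; apply/andP; split; lra.
- exact: L2_torus_integrable.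
Qed.

(** Lebesgue's differentiation theorem for [f] cut to [0,1), which is integrable because
    square-integrable functions on a finite measure space are. *)
Lemma primitive_derive :
  {ae @dx_torus R, forall u, 0 < u -> derivable primitive u 1 /\ derive1 primitive u = f u}.
Proof.
apply: ae_torusP.
have loc : locally_integrable [set: R] f1.
  exact: (integrable_locally measurable_torus_itv L2_torus_integrable).
have int_y y : leb.-integrable [set` Interval (BLeft (-1)) (BRight y)] (EFin \o f1).
  by apply: f1_int; exact: measurable_itv.
have := FTC1 int_y loc; apply: filterS; first exact: (ae_filter_ringOfSetsType leb).
move=> u /= h Du u0.
have [|d1 d2] := h; first by rewrite lte_fin; lra.
by split => //; rewrite d2 /f1 patchE mem_set.
Qed.
End primitive.

(** Used with c = 0 for a periodic function and with c = V 1 - V 0 for [V], to bring a difference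
    quotient back to the fractional part of its base point. *)
Lemma shift_intE {R : realType} (f : R -> R) (c : R) :
  (forall u, f (u + 1) = f u + c) -> forall (n : int) u, f (u + n%:~R) = f u + n%:~R * c.
Proof.
move=> fS; have fN (n : nat) u : f (u + n%:R) = f u + n%:R * c.
  elim: n => [|n ih]; first by rewrite addr0 mul0r addr0.
  by rewrite -natr1 addrA fS ih mulrDl mul1r addrA.
case=> n u; first exact: fN.
have := fN n.+1 (u + (Negz n)%:~R); rewrite NegzE mulrNz -pmulrn addrNK => ->.
by ring.
Qed.

(** * Generalized derivatives of functions in the one-dimensional domain *)

Section generalized_primitive.
Context {R : realType} (V : cumulative R R).
Hypothesis V_adm : W_admissible V.
Local Notation T := (measurableTypeR R).
Local Notation leb := (@lebesgue_measure R).
Local Notation LS := (lebesgue_stieltjes_measure V).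
Variables (phi f : R -> R) (a b : R).
Hypothesis phi_per : forall u, phi (u + 1) = phi u.
Hypothesis f2 : f \in Lfun (@dx_torus R) 2%:E.
Hypothesis f0 : \int[@dx_torus R]_z f z = 0.
Let F y := \int[leb]_(z in `[0, y]) f z.
Hypothesis mean0 : \int[LS]_(y in `]0, 1]) (b + F y) = 0.
Hypothesis phiE : forall x, 0 <= x < 1 -> phi x = a + b * V x + \int[LS]_(y in `]0, x]) F y.

Let g y := b + primitive f y.

Let V_lt s t : s < t -> V s < V t.
Proof. by case: V_adm => h _; exact: h. Qed.

Let V_per u : V (u + 1) = V u + (V 1 - V 0).
Proof. by case: V_adm => _ h; rewrite -(h u); ring. Qed.

Let g_bounded : exists2 M, 0 <= M & forall y, `|g y| <= M.
Proof.
have [M M0 hM] := primitive_bounded f2.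
exists (`|b| + M) => [|y]; first by rewrite addr_ge0.
by apply: (le_trans (ler_normD _ _)); rewrite lerD2l.
Qed.

Let sub_oc (s t : R) : 0 <= s -> t <= 1 -> `]s, t]%classic `<=` `[0, 1]%classic.
Proof.
move=> s0 t1 x /=; rewrite !in_itv/= => /andP[? ?]; apply/andP; split; lra.
Qed.

Let LS_oc_lty (s t : R) : (LS (`]s, t] : set T) < +oo)%E.
Proof.
have [st|ts] := leP s t; first by rewrite lebesgue_stieltjes_ocitv// ltry.
by rewrite set_itv_ge ?measure0// bnd_simp -leNgt ltW.
Qed.

Let bounded_int (h : R -> R) (s t : R) : 0 <= s -> t <= 1 ->
  measurable_fun (`[0, 1]%classic : set T) h -> (exists M, forall y, `|h y| <= M) ->
  LS.-integrable (`]s, t] : set T) (EFin \o h).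
Proof.
move=> s0 t1 mh [M hM]; apply: measurable_bounded_integrable => //.
- exact: LS_oc_lty.
- by apply: measurable_funS mh => //; exact: sub_oc.
- exists M; split; first exact: num_real.
by move=> N MN y _; apply: (le_trans (hM y)); exact: ltW.
Qed.

Let primitive_int (s t : R) : 0 <= s -> t <= 1 ->
  LS.-integrable (`]s, t] : set T) (EFin \o primitive f).
Proof.
move=> s0 t1; apply: bounded_int => //; first exact: measurable_primitive.
by have [M _ hM] := primitive_bounded f2; exists M.
Qed.

Let cst_int (c s t : R) : LS.-integrable (`]s, t] : set T) (EFin \o cst c).
Proof.
apply: measurable_bounded_integrable => //; first exact: LS_oc_lty.
exists `|c|; split; first exact: num_real.
by move=> N MN y _; exact: ltW.
Qed.

Let g_int (s t : R) : 0 <= s -> t <= 1 -> LS.-integrable (`]s, t] : set T) (EFin \o g).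
Proof.
move=> s0 t1; apply: bounded_int => //.
  by apply: measurable_funD => //; exact: measurable_primitive.
by have [M _ hM] := g_bounded; exists M.
Qed.

Let Rintegral_cst_oc c s t : s <= t -> \int[LS]_(y in `]s, t]) c = c * (V t - V s).
Proof.
move=> st; rewrite Rintegral_cst// [X in fine X](_ : _ = (V t - V s)%:E)//.
exact: lebesgue_stieltjes_ocitv.
Qed.

Let phi_incr0 (x : R) : 0 <= x <= 1 -> phi x - phi 0 = \int[LS]_(y in `]0, x]) g y.
Proof.
have FE t : t <= 1 -> \int[LS]_(y in `]0, t]) F y = \int[LS]_(y in `]0, t]) primitive f y.
  move=> t1; apply: eq_Rintegral => y; rewrite inE/= in_itv/= => /andP[y0 yt].
  by rewrite /F primitiveE// (ltW y0) (le_trans yt).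
(* The point x = 1 lies outside the range of [phiE]: there the left side vanishes by periodicity and
   the right side by [mean0]. *)
move=> /andP[x0]; rewrite le_eqVlt => /predU1P[->|x1].
  rewrite -[X in phi X]add0r phi_per subrr -[LHS]mean0; apply: eq_Rintegral => y.
  rewrite inE/= in_itv/= => /andP[y0 y1].
  by rewrite /F primitiveE// (ltW y0).
rewrite !phiE ?x0 ?lexx ?ltr01//.
rewrite [X in _ - X](_ : _ = a + b * V 0); last first.
  by rewrite set_itvoc0 Rintegral_set0 addr0.
rewrite FE ?ltW// RintegralD//; [|exact: cst_int|by apply: primitive_int => //; exact: ltW].
by rewrite Rintegral_cst_oc//; ring.
Qed.

Lemma increment_integral (s t : R) : 0 <= s -> s <= t -> t <= 1 ->
  phi t - phi s = \int[LS]_(y in `]s, t]) g y.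
Proof.
move=> s0 st t1.
have -> : phi t - phi s = (phi t - phi 0) - (phi s - phi 0) by ring.
rewrite !phi_incr0 ?s0 ?(le_trans st) ?(le_trans s0)//.
rewrite (@itv_bndbnd_setU _ _ (BRight 0) (BRight s) (BRight t)) ?bnd_simp//.
rewrite Rintegral_setU//.
- by rewrite addrC addKr.
- by rewrite -itv_bndbnd_setU ?bnd_simp//; exact: g_int.
- by apply/disj_setPS => y /= []; rewrite !in_itv/= => /andP[_ h1] /andP[h2 _]; lra.
Qed.

(** The quotient is the mean of [g] over (s,t] with respect to dV, so it stays as close to c as [g]
    does. Strict monotonicity of [V] keeps the mass of (s,t] positive. *)
Lemma difference_quotient_le (s t c e : R) : 0 <= s -> s < t -> t <= 1 ->
  (forall y, s <= y <= t -> `|g y - c| <= e) ->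
  `|(phi t - phi s) / (V t - V s) - c| <= e.
Proof.
move=> s0 st t1 ge; have st' := ltW st.
have Vst : 0 < V t - V s by rewrite subr_gt0 V_lt.
have -> : (phi t - phi s) / (V t - V s) - c = (phi t - phi s - c * (V t - V s)) / (V t - V s).
  by field; rewrite gt_eqF.
rewrite normrM normfV (gtr0_norm Vst) ler_pdivrMr// increment_integral //.
rewrite -Rintegral_cst_oc // -RintegralB//; last 2 first.
- exact: g_int.
- exact: cst_int.
have gc_int : LS.-integrable (`]s, t] : set T) (EFin \o (fun y => g y - c)).
  by apply: (integrableB _ (g_int s0 t1) (cst_int c s t)).
apply: (le_trans (le_normr_Rintegral _ gc_int)) => //.
rewrite -[leRHS]Rintegral_cst_oc //; apply: le_Rintegral => //.
- exact: integrable_norm.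
- exact: cst_int.
- by move=> y /=; rewrite in_itv/= => /andP[sy yt]; apply: ge; rewrite (ltW sy).
Qed.

Let g0 : g 1 = g 0.
Proof. by rewrite /g primitive1// primitive0. Qed.

Let cvg_g (u : R) : -1 < u -> g x @[x --> u] --> g u.
Proof. by move=> u1; apply: cvgD; [exact: cvg_cst|exact: continuous_primitive]. Qed.

Let near_g (u e : R) : -1 < u -> 0 < e ->
  exists2 d, 0 < d & forall y, `|u - y| < d -> `|g y - g u| <= e.
Proof.
move=> u1 e0; have /cvgrPdist_le/(_ e e0)/nbhs_ballP[d /= d0 hd] := cvg_g u1.
by exists d => // y uy; rewrite distrC; exact: hd.
Qed.

Let right_quotient (u e : R) : 0 <= u < 1 -> 0 < e -> exists2 d, 0 < d &
  forall h, 0 < h < d -> `|(phi (u + h) - phi u) / (V (u + h) - V u) - g u| <= e.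
Proof.
move=> /andP[u0 u1] e0; have [|d d0 hd] := @near_g u e _ e0; first lra.
exists (Num.min d (1 - u)) => [|h]; first by rewrite lt_min d0 subr_gt0.
rewrite lt_min => /and3P[h0 hd' hu]; apply: difference_quotient_le => //; try lra.
by move=> y /andP[uy yh]; apply: hd; rewrite ltr_norml; apply/andP; split; lra.
Qed.

Let left_quotient (u e : R) : 0 < u <= 1 -> 0 < e -> exists2 d, 0 < d &
  forall h, 0 < h < d -> `|(phi (u - h) - phi u) / (V (u - h) - V u) - g u| <= e.
Proof.
move=> /andP[u0 u1] e0; have [|d d0 hd] := @near_g u e _ e0; first lra.
exists (Num.min d u) => [|h]; first by rewrite lt_min d0.
rewrite lt_min => /and3P[h0 hd' hu].
rewrite -(opprB (phi u)) -(opprB (V u)) invrN mulrNN.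
apply: difference_quotient_le => //; try lra.
by move=> y /andP[uy yh]; apply: hd; rewrite ltr_norml; apply/andP; split; lra.
Qed.

Let two_sided_quotient (u e : R) : 0 <= u < 1 -> 0 < e -> exists2 d, 0 < d &
  forall h, h != 0 -> `|h| < d ->
    `|(phi (u + h) - phi u) / (V (u + h) - V u) - g u| <= e.
Proof.
move=> /[dup] u01 /andP[u0 u1] e0.
have [d1 d10 hd1] := right_quotient u01 e0.
have [d2 d20 hd2] : exists2 d, 0 < d & forall h, 0 < h < d ->
    `|(phi (u - h) - phi u) / (V (u - h) - V u) - g u| <= e.
  move: u0; rewrite le_eqVlt => /predU1P[<-|u0]; last first.
    by apply: left_quotient => //; rewrite u0 ltW.
  have [|d d0 hd] := @left_quotient 1 e _ e0; first by rewrite ltr01 lexx.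
  exists d => // h /hd; rewrite g0; congr (`|_ / _ - _| <= _).
    by rewrite -[in RHS]phi_per -[in X in _ = _ - X]phi_per; congr (phi _ - phi _); ring.
  have -> : 1 - h = (0 - h) + 1 by ring.
  by rewrite V_per; ring.
exists (Num.min d1 d2) => [|h h0]; first by rewrite lt_min d10.
rewrite lt_min => /andP[h1 h2].
have [hp|hn] := ltP 0 h; first by apply: hd1; rewrite hp -(gtr0_norm hp).
have hn' : h < 0 by rewrite lt_neqAle h0.
have := hd2 (- h); rewrite opprK; apply.
by rewrite oppr_gt0 hn' -(ltr0_norm hn').
Qed.

(** The 1-periodic extension of [g] from [0,1), continuous because g 1 = g 0. It is the generalized
    derivative of [phi] at every real point. *)
Definition periodic_primitive (u : R) : R := b + primitive f (u - (Num.floor u)%:~R).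
Local Notation G := periodic_primitive.

Let frac_itv (u : R) : 0 <= u - (Num.floor u)%:~R < 1.
Proof.
by rewrite subr_ge0 floor_le ltrBlDl -(intrD1 _) floorD1_gt.
Qed.

Lemma periodic_primitiveE (u : R) : 0 <= u < 1 -> G u = b + primitive f u.
Proof.
move=> u01; have -> : G u = b + primitive f (u - (Num.floor u)%:~R) by [].
by rewrite (@floor_def _ _ 0) ?subr0.
Qed.

Lemma cvg_difference_quotient (u : R) :
  (phi (u + h) - phi u) / (V (u + h) - V u) @[h --> 0^'] --> G u.
Proof.
apply/cvgrPdist_le => e e0; pose n := Num.floor u; pose r := u - n%:~R.
have [d d0 hd] := two_sided_quotient (frac_itv u) e0.
exists d => // h /=; rewrite sub0r normrN => hd' h0.
rewrite distrC.
have ur : u = r + n%:~R by rewrite /r subrK.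
have phi0 v : phi (v + 1) = phi v + 0 by rewrite phi_per addr0.
have -> : phi (u + h) - phi u = phi (r + h) - phi r.
  by rewrite [in LHS]ur (addrAC r) !(shift_intE phi0) !mulr0 !addr0.
have -> : V (u + h) - V u = V (r + h) - V r.
  by rewrite [in LHS]ur (addrAC r) !(shift_intE V_per); ring.
exact: hd.
Qed.

Lemma periodic_primitive_bounded : exists2 M, 0 <= M & forall y, `|G y| <= M.
Proof. by have [M M0 hM] := g_bounded; exists M => // y; exact: hM. Qed.

Lemma measurable_periodic_primitive : measurable_fun setT G.
Proof.
have -> : G = (fun x => b + (primitive f \_ `[0, 1[) x) \o (fun u => u - (Num.floor u)%:~R).
  by apply/funext => u /=; rewrite patchE mem_set//= in_itv/=.
apply: measurableT_comp.
  apply: measurable_funD => //.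
  apply/(measurable_restrictT _ _).1; first exact: measurable_itv.
  apply: measurable_funS (measurable_primitive f2); first exact: measurable_itv.
  by move=> x /=; rewrite !in_itv/= => /andP[? ?]; apply/andP; split; lra.
apply: measurable_funB => //.
apply: nondecreasing_measurable => // x y xy; rewrite ler_int; exact: le_floor.
Qed.

Lemma derive_periodic_primitive :
  {ae @dx_torus R, forall u, derivable G u 1 /\ derive1 G u = f u}.
Proof.
(* The point 0 is discarded: only on its right is the periodic extension given by [primitive f]. *)
have ae0 : {ae @dx_torus R, forall u, u != 0}.
  apply: ae_torusP; exists [set 0]; split.
  - exact: measurable_set1.
  - exact: lebesgue_measure_set1.
  - by move=> u /= u0; apply: contrapT => /eqP u0'; apply: u0 => _.
have ae1 : {ae @dx_torus R, forall u, 0 <= u < 1} by exact: ae_torus_in.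
have ae2 := primitive_derive f2.
move: ae0 ae1 ae2; apply: filterS3; first exact: (ae_filter_ringOfSetsType dx_torus).
move=> u u0 /andP[u0' u1] h.
have {}u0 : 0 < u by rewrite lt_neqAle eq_sym u0.
have [d1 d2] := h u0.
have nearG : \near u, (fun x => b + primitive f x) u = G u.
  have : \near u, u \in `]0, 1[ by apply: near_in_itvoo; rewrite in_itv/= u0.
  apply: filterS => x; rewrite in_itv/= => /andP[x0 x1].
  by rewrite periodic_primitiveE// ltW.
split; first by apply: (near_eq_derivable nearG); apply: derivableD.
rewrite derive1E -(near_eq_derive _ nearG) deriveD//.
by rewrite derive_cst add0r -derive1E.
Qed.

Lemma periodic_primitive_increment (x : R) : 0 <= x < 1 ->
  phi x - phi 0 = \int[LS]_(y in `]0, x]) G y.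
Proof.
move=> /andP[x0 x1]; rewrite (increment_integral (lexx 0) x0 (ltW x1)).
apply: eq_Rintegral => y.
rewrite inE/= in_itv/= => /andP[y0 yx]; rewrite periodic_primitiveE//.
by rewrite ltW//= (le_lt_trans yx).
Qed.

End generalized_primitive.

(** * Passing between the fundamental domains [0,1) and (0,1] *)

Section periodic_atoms.
Context {R : realType} (V : cumulative R R).
Hypothesis V_adm : W_admissible V.
Local Notation T := (measurableTypeR R).
Local Notation LS := (lebesgue_stieltjes_measure V).

Lemma cvg_lebesgue_stieltjes_set1 (c : R) :
  (V c - V (c - n.+1%:R^-1))%:E @[n --> \oo] --> LS ([set c] : set T).
Proof.
rewrite set1_bigcap_oc.
have -> : (fun n => (V c - V (c - n.+1%:R^-1))%:E) =
    LS \o (fun n => `]c - n.+1%:R^-1, c]%classic : set T).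
  apply/funext => n /=; rewrite lebesgue_stieltjes_ocitv//.
  by rewrite lerBlDr lerDl invr_ge0.
apply: nonincreasing_cvg_mu.
- rewrite [ltLHS](_ : _ = (V c - V (c - 1%:R^-1))%:E) ?ltry//.
  by apply: lebesgue_stieltjes_ocitv; rewrite lerBlDr lerDl invr_ge0.
- by move=> i; exact: measurable_itv.
- by rewrite -set1_bigcap_oc; exact: measurable_set1.
- move=> m n mn; apply/subsetPset; apply: subset_itvr.
  by rewrite bnd_simp lerD2l lerN2 lef_pV2 ?posrE// ler_nat.
Qed.

(** An atom is the limit of the increments of [V] over shrinking intervals to its left, and these
    increments are invariant under translation by 1. *)
Lemma lebesgue_stieltjes_atom : LS ([set 0] : set T) = LS ([set 1] : set T).
Proof.
have c0 := @cvg_lebesgue_stieltjes_set1 0.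
have c1 := @cvg_lebesgue_stieltjes_set1 1.
move: c0; rewrite (_ : (fun n => _) = (fun n => (V 1 - V (1 - n.+1%:R^-1))%:E)) => [c0|].
  exact: (cvg_unique _ c0 c1).
apply/funext => n; congr (_%:E).
have [_ h] := V_adm; have := h (0 - n.+1%:R^-1).
rewrite (_ : 0 - _ + 1 = 1 - n.+1%:R^-1); [lra|ring].
Qed.

(** The two intervals share ]0,1[ and differ by the points 0 and 1, which carry equal mass and equal
    values of [h]. *)
Lemma Rintegral_torus_oc (h : R -> R) :
  measurable_fun (setT : set T) h -> (exists M, forall y, `|h y| <= M) -> h 0 = h 1 ->
  \int[dW_torus V]_x h x = \int[LS]_(x in `]0, 1]) h x.
Proof.
move=> mh [M hM] h01; rewrite Rintegral_torus.
have h_int (A : set T) : measurable A -> A `<=` `[0, 1]%classic -> LS.-integrable A (EFin \o h).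
  move=> mA A01; apply: measurable_bounded_integrable => //.
  - apply: (@le_lt_trans _ _ (LS (`]-1, 1] : set T))).
      apply: le_measure; rewrite ?inE//.
      move=> x /A01 /=; rewrite !in_itv/= => /andP[x0 ->]; rewrite andbT; lra.
    rewrite [ltLHS](_ : _ = (V 1 - V (-1))%:E) ?ltry//.
    by apply: lebesgue_stieltjes_ocitv; lra.
  - exact: measurable_funS mh.
  - exists M; split; first exact: num_real.
    by move=> N MN y _; apply: (le_trans (hM y)); exact: ltW.
have h1 (c : R) : \int[LS]_(x in [set c]) h x = h c * fine (LS ([set c] : set T)).
  rewrite (@eq_Rintegral _ _ _ _ _ (cst (h c))) ?Rintegral_cst//.
  by move=> x; rewrite inE => ->.
rewrite -(@setU1itv _ _ (BLeft 1) 0 false) ?bnd_simp//.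
rewrite -(@setUitv1 _ _ (BRight 0) 1 true) ?bnd_simp//.
have m1 (c : R) : measurable ([set c] : set T) by exact: measurable_set1.
have moo : measurable (`]0, 1[%classic : set T) by exact: measurable_itv.
have in01 (x : R) : `]0, 1[%classic x -> `[0, 1]%classic x.
  by rewrite /= !in_itv/= => /andP[? ?]; apply/andP; split; lra.
have in0 : `[0, 1]%classic (0 : R) by rewrite /= in_itv/= lexx ler01.
have in1 : `[0, 1]%classic (1 : R) by rewrite /= in_itv/= lexx ler01.
rewrite !Rintegral_setU//.
- by rewrite !h1 h01 lebesgue_stieltjes_atom addrC.
- by apply: h_int; [exact: measurableU|move=> x [/in01|->]].
- by apply/disj_setPS => x /= [] /[swap] ->; rewrite in_itv/= ltxx andbF.
- by apply: h_int; [exact: measurableU|move=> x [->|/in01]].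
- by apply/disj_setPS => x /= [] ->; rewrite in_itv/= ltxx.
Qed.
End periodic_atoms.

Lemma Rintegral_Fubini {R : realType} {d1 d2 : measure_display}
    {T1 : measurableType d1} {T2 : measurableType d2}
    (m1 : {finite_measure set T1 -> \bar R}) (m2 : {finite_measure set T2 -> \bar R})
    (H : T1 * T2 -> R) : (m1 \x m2)%E.-integrable setT (EFin \o H) ->
  \int[m1]_x \int[m2]_y H (x, y) = \int[m2]_y \int[m1]_x H (x, y).
Proof.
move=> H_int; have := Fubini H_int => F; rewrite /Rintegral.
rewrite (@eq_ae_integral _ _ _ _ _ (fun x => \int[m2]_y (H (x, y))%:E)%E); last first.
  apply: filterS (ae_integrable1 H_int) => x ix.
  by rewrite fineK//; exact: integrable_fin_num.
rewrite [in RHS](@eq_ae_integral _ _ _ _ _ (fun y => \int[m1]_x (H (x, y))%:E)%E); last first.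
  apply: filterS (ae_integrable2 H_int) => x ix.
  by rewrite fineK//; exact: integrable_fin_num.
by congr fine.
Qed.

(** * Integration by parts in one dimension *)

Section regular.
Context {R : realType} (V : cumulative R R).
Hypothesis V_adm : W_admissible V.
Local Notation T := (measurableTypeR R).
Local Notation dx1 := (@dx_torus R).
Local Notation LS := (lebesgue_stieltjes_measure V).

(* [phi] is in the domain of the one-dimensional operator, [G] is its
   generalized derivative and [f] is the derivative of [G]. *)
Record W_regular (phi f G : R -> R) : Prop := WRegular {
  regular_L2 : phi \in Lfun dx1 2%:E;
  regular_rhs_L2 : f \in Lfun dx1 2%:E;
  regular_rhs_mean0 : \int[dx1]_x f x = 0;
  regular_primitive : exists b, forall u, 0 <= u < 1 -> G u = b + primitive f u;
  regular_increment : forall x, 0 <= x < 1 -> phi x - phi 0 = \int[LS]_(y in `]0, x]) G y;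
  regular_measurable : measurable_fun (setT : set T) G;
  regular_bounded : exists2 M, 0 <= M & forall y, `|G y| <= M;
  regular_cvg : forall u : R,
    (phi (u + h) - phi u) / (V (u + h) - V u) @[h --> 0^'] --> G u;
  regular_derive : {ae dx1, forall u, derivable G u 1 /\ derive1 G u = f u};
  regular_mean0 : \int[dW_torus V]_x G x = 0
}.

Lemma L_graph_regular phi f : L_graph V phi f -> exists G, W_regular phi f G.
Proof.
case=> phi2 phi_per f2 f0 [a [b [mean0 phiE]]].
have G01 : periodic_primitive f b 1 = periodic_primitive f b 0.
  by rewrite /periodic_primitive floor1 floor0 subr0 subrr.
exists (periodic_primitive f b); split.
- exact: phi2.
- exact: f2.
- exact: f0.
- by exists b => u u01; exact: periodic_primitiveE.
- by move=> x x01; exact: (periodic_primitive_increment phi_per f2 mean0 phiE x01).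
- exact: measurable_periodic_primitive.
- exact: periodic_primitive_bounded.
- by move=> u; exact: (cvg_difference_quotient V_adm phi_per f2 f0 mean0 phiE).
- exact: derive_periodic_primitive.
(* The domain condition is a zero mean over (0,1]; since G 0 = G 1 it becomes a zero mean over the
   torus [0,1). *)
- have [M _ hM] := periodic_primitive_bounded b f2.
  have -> := Rintegral_torus_oc V_adm (measurable_periodic_primitive b f2)
    (ex_intro _ M hM) (esym G01).
  rewrite -[RHS]mean0; apply: eq_Rintegral => y; rewrite inE/= in_itv/= => /andP[y0].
    rewrite le_eqVlt => /predU1P[->|y1].
      rewrite primitiveE ?lexx ?ler01// primitive1// G01 periodic_primitiveE ?lexx ?ltr01//.
      by rewrite primitive0.
    rewrite periodic_primitiveE; last by rewrite (ltW y0) y1.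
    by rewrite primitiveE// (ltW y0) (ltW y1).
Qed.

Lemma regular_deriv_L2 phi f G : W_regular phi f G -> G \in Lfun (dW_torus V) 2%:E.
Proof.
move=> r; apply/L2P; split; first exact: regular_measurable r.
have [M M0 hM] := regular_bounded r.
apply: (@le_lt_trans _ _ (\int[dW_torus V]_x (M ^+ 2)%:E)%E).
  apply: ge0_le_integral => //.
  - by move=> x _; rewrite lee_fin sqr_ge0.
  - by apply/measurable_EFinP; apply: measurable_funX; exact: regular_measurable r.
  - move=> x _; rewrite lee_fin -[leLHS]real_normK ?num_real//.
    by rewrite ler_sqr ?nnegrE.
by apply: integrable_lty => //; exact: finite_measure_integrable_cst.
Qed.

(** The triangle of the Fubini argument. The point y = 0 is excluded because the increment of a
    function from 0 to x is an integral over ]0,x], which does not see the atom at 0. *)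
Let S : set (T * T) := [set z | 0 < z.2 /\ z.2 <= z.1].

Let mS : measurable S.
Proof.
have m1 := measurable_fun_ltr (measurable_cst (0 : R))
  (@measurable_snd _ _ T T : measurable_fun setT (snd : T * T -> R)).
have m2 := measurable_fun_ler
  (@measurable_snd _ _ T T : measurable_fun setT (snd : T * T -> R))
  (@measurable_fst _ _ T T : measurable_fun setT (fst : T * T -> R)).
have -> : S = (fun z => 0 < z.2) @^-1` [set true] `&` (fun z => z.2 <= z.1) @^-1` [set true].
  by apply/seteqP; split => z /=.
by apply: measurableI; rewrite -[X in measurable X]setTI; [exact: m1|exact: m2].
Qed.

Let SE (x y : R) : \1_S (x, y) = ((0 < y) && (y <= x))%:R :> R.
Proof.
rewrite indicE (_ : ((x, y) \in S) = (0 < y) && (y <= x))//.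
by apply/idP/idP => [/set_mem[/= -> ->]//|/andP[y0 yx]]; apply/mem_set.
Qed.

(** As [f] has zero mean, psi may be replaced by psi - psi 0, the integral of [K] over ]0,x].
    Exchanging integrals leaves, for 0 < y < 1, the integral of [f] over [y,1[, which is b - G y;
    the constant b disappears because [K] has zero mean. *)
Lemma regular_integration_by_parts phi f G psi h K :
  W_regular phi f G -> W_regular psi h K ->
  ip dx1 f psi = - ip (dW_torus V) G K.
Proof.
move=> r s.
have f2 := regular_rhs_L2 r; have f0 := regular_rhs_mean0 r.
have f1 : dx1.-integrable setT (EFin \o f).
  by apply/Lfun1_integrable; apply: Lfun_subset12 f2; exact: fin_num_measure.
have [M M0 hM] := regular_bounded s.
have mf : measurable_fun (setT : set T) f := L2_measurable f2.
have mK := regular_measurable s.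
pose H (z : T * T) : R := f z.1 * (\1_S z * K z.2).
have mH : measurable_fun setT H.
  apply: measurable_funM; first exact: measurableT_comp.
  apply: measurable_funM; first exact: measurable_indic.
  exact: measurableT_comp.
(* The bound on [K] dominates the integrand by M |f|, integrable for the product of two finite
   measures. *)
have H_int : (dx1 \x dW_torus V)%E.-integrable setT (EFin \o H).
  apply: (@le_integrable _ _ _ _ _ _ _ (fun z : T * T => (f z.1 * (cst M) z.2)%:E)) => //.
  - exact/measurable_EFinP.
  - move=> z _; rewrite lee_fin !normrM ler_wpM2l// indicE.
    case: (z \in S); rewrite ?normr1 ?normr0 ?mul1r ?mul0r//=.
    by rewrite (ger0_norm M0); exact: hM.
  - by apply: integrable_tensor => //; exact: finite_measure_integrable_cst.
have psi2 := regular_L2 s; have K2 := regular_deriv_L2 s.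
have c2 (c : R) : (fun=> c) \in Lfun dx1 2%:E by exact: Lfun_cst.
have -> : ip dx1 f psi = \int[dx1]_x \int[dW_torus V]_y H (x, y).
  transitivity (ip dx1 f (psi \- (fun=> psi 0))).
    rewrite ipBr// -[LHS]subr0; congr (_ - _).
    by rewrite /ip RintegralZr// f0 mul0r.
  apply: eq_ae_Rintegral; apply: ae_torus_in => x /[dup] x01 /andP[x0 x1].
  rewrite /= (regular_increment s)// /H/= RintegralZl//; last first.
    apply: (@le_integrable _ _ _ _ _ _ _ (cst M%:E)) => //.
    - apply/measurable_EFinP; apply: measurable_funM => //.
      exact: (measurableT_comp (measurable_indic mS) (measurable_pair1 x)).
    - move=> y _; rewrite lee_fin normrM SE (ger0_norm M0).
      by case: (_ && _); rewrite ?normr1 ?normr0 ?mul1r ?mul0r ?hM.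
    - exact: finite_measure_integrable_cst.
  congr (_ * _); rewrite Rintegral_torus.
  rewrite (_ : `]0, x]%classic = `[0, 1[%classic `&` `]0, x]%classic); last first.
    apply/seteqP; split => y /=; rewrite !in_itv/=; last by case.
    by move=> /andP[? ?]; split; apply/andP; split; lra.
  rewrite Rintegral_mkcondr; apply: eq_Rintegral => y _.
  rewrite patchE SE (_ : (y \in `]0, x]%classic) = (0 < y) && (y <= x)); last first.
    by apply/idP/idP; rewrite inE/= in_itv.
  by case: (_ && _); rewrite ?mul1r ?mul0r.
rewrite Rintegral_Fubini//.
have [b GE] := regular_primitive r.
have -> : - ip (dW_torus V) G K = - ip (dW_torus V) (G \- (fun=> b)) K.
  have b2 : (fun=> b) \in Lfun (dW_torus V) 2%:E by exact: Lfun_cst.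
  have K1 : (dW_torus V).-integrable setT (EFin \o K).
    by apply/Lfun1_integrable; apply: Lfun_subset12 K2; exact: fin_num_measure.
  rewrite ipBl//; last exact: regular_deriv_L2 r.
  by rewrite [X in _ - X]RintegralZl// (regular_mean0 s) mulr0 subr0.
rewrite -ipNl//; last first.
  by apply: L2B; [exact: regular_deriv_L2 r|exact: Lfun_cst].
apply: eq_ae_Rintegral; apply: ae_torus_in => y /[dup] y01 /andP[y0 y1].
rewrite /= GE// addrC addKr.
under eq_Rintegral do rewrite /H/= mulrA.
rewrite RintegralZr//; last first.
  apply: (le_integrable _ _ _ f1) => //.
  - apply/measurable_EFinP; apply: measurable_funM => //.
    exact: (measurableT_comp (measurable_indic mS) (measurable_pair2 y)).
  - move=> x _; rewrite lee_fin normrM SE.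
    by case: (_ && _); rewrite ?normr1 ?normr0 ?mulr1 ?mulr0.
congr (_ * _); rewrite Rintegral_torus.
(* At y = 0, possibly an atom of dV, both sides vanish: the triangle omits y = 0 and [primitive f 0]
   is 0. *)
move: y0; rewrite le_eqVlt => /predU1P[<-|y0].
  rewrite primitive0// oppr0 (@eq_Rintegral _ _ _ _ _ (fun=> 0)).
    by rewrite Rintegral_cst ?mul0r//; exact: measurable_itv.
  by move=> x _; rewrite SE ltxx mulr0.
rewrite -primitive_tail//.
rewrite (_ : `[y, 1[%classic = `[0, 1[%classic `&` `[y, +oo[%classic); last first.
  apply/seteqP; split => x /=; rewrite !in_itv/= ?andbT.
    by move=> /andP[? ?]; split => //; apply/andP; split; lra.
  by move=> [/andP[_ ->] ->].
rewrite Rintegral_mkcondr; apply: eq_Rintegral => x _.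
rewrite patchE SE y0/= (_ : (x \in `[y, +oo[%classic) = (y <= x)); last first.
  by apply/idP/idP; rewrite inE/= in_itv/= andbT.
by case: (_ <= _); rewrite ?mulr1 ?mulr0.
Qed.
End regular.

(** * Generalized derivatives on the torus *)

Section differentiable.
Context {R : realType} {d : nat}.
Variable W : 'I_d -> cumulative R R.
Local Notation T := (measurableTypeR R).
Local Notation X := (d.-tuple T).
Local Notation dx := (@dx R d).
Implicit Types (f g h : X -> R) (x : X) (i : 'I_d).

Definition W_quotient i f x (e : R) : R :=
  (slice f i x (tnth x i + e) - slice f i x (tnth x i)) /
  (W i (tnth x i + e) - W i (tnth x i)).

Lemma partial_W_unique i f x (l : R) :
  W_quotient i f x e @[e --> 0^'] --> l -> partial_W W i f x = l.
Proof. by move=> /cvg_lim; apply; exact: Rhausdorff. Qed.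

(** [partial_x] has a default value where the derivative fails to exist, so it is handled through a
    square-integrable representative [dd]. Asking for [is_derive] rather than an equality of values
    keeps the notion stable under linear combinations. *)
Definition second_derivative i f (dd : X -> R) : Prop :=
  dd \in Lfun dx 2%:E /\
  {ae dx, forall x, is_derive (tnth x i) (1 : R) (slice (partial_W W i f) i x) (dd x)}.

Lemma second_derivative_ae i f dd : second_derivative i f dd ->
  {ae dx, forall x, partial_x i (partial_W W i f) x = dd x}.
Proof.
case=> _; apply: filterS => x [_ <-].
by rewrite /partial_x derive1E.
Qed.

(** The properties of elements of the span that survive linear combinations. The quotients converge
    at every point, so [partial_W] is linear as an operation on functions and its slices can be
    differentiated again. *)
Record W_smooth f : Prop := WSmooth {
  smooth_L2 : f \in Lfun dx 2%:E;
  smooth_cvg : forall i x, W_quotient i f x e @[e --> 0^'] --> partial_W W i f x;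
  smooth_partial_L2 : forall i, partial_W W i f \in Lfun (dxW W i) 2%:E;
  smooth_partial_mean0 : forall i, \int[dxW W i]_x partial_W W i f x = 0;
  smooth_second : forall i, exists dd, second_derivative i f dd
}.

Lemma partial_W_linear i f g (c : R) : W_smooth f -> W_smooth g ->
  partial_W W i (fun x => f x + c * g x) =
  fun x => partial_W W i f x + c * partial_W W i g x.
Proof.
move=> sf sg; apply/funext => x; apply: partial_W_unique.
rewrite (_ : (fun e => _) = fun e => W_quotient i f x e + c * W_quotient i g x e).
  by apply: cvgD; [exact: smooth_cvg|apply: cvgM; [exact: cvg_cst|exact: smooth_cvg]].
by apply/funext => e; rewrite /W_quotient /slice; ring.
Qed.

Lemma second_derivative_linear i f g (c : R) ddf ddg : W_smooth f -> W_smooth g ->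
  second_derivative i f ddf -> second_derivative i g ddg ->
  second_derivative i (fun x => f x + c * g x) (fun x => ddf x + c * ddg x).
Proof.
move=> sf sg [ddf2 aef] [ddg2 aeg]; split; first by apply: L2D => //; exact: L2Z.
rewrite partial_W_linear//; apply: filterS2 aef aeg => x df dg.
exact: (is_deriveD df (is_deriveZ c dg)).
Qed.

Lemma W_smooth_linear f g (c : R) : W_smooth f -> W_smooth g ->
  W_smooth (fun x => f x + c * g x).
Proof.
move=> sf sg; split.
- by apply: L2D; [exact: smooth_L2|apply: L2Z; exact: smooth_L2].
- move=> i x; rewrite partial_W_linear//.
  rewrite (_ : (fun e => _) = fun e => W_quotient i f x e + c * W_quotient i g x e).
    by apply: cvgD; [exact: smooth_cvg|apply: cvgM; [exact: cvg_cst|exact: smooth_cvg]].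
  by apply/funext => e; rewrite /W_quotient /slice; ring.
- move=> i; rewrite partial_W_linear//; apply: L2D; first exact: smooth_partial_L2.
  by apply: L2Z; exact: smooth_partial_L2.
- have int1 k (u : X -> R) : u \in Lfun (dxW W k) 2%:E ->
      (dxW W k).-integrable setT (EFin \o u).
    move=> u2; apply/Lfun1_integrable.
    by apply: (Lfun_subset12 _ u2); exact: fin_num_measure.
  move=> i; have f2 := smooth_partial_L2 sf i; have g2 := smooth_partial_L2 sg i.
  rewrite partial_W_linear// RintegralD//; [|exact: int1|by apply: int1; exact: L2Z].
  by rewrite RintegralZl ?int1// !smooth_partial_mean0// mulr0 addr0.
- move=> i; have [ddf hf] := smooth_second sf i; have [ddg hg] := smooth_second sg i.
  by exists (fun x => ddf x + c * ddg x); exact: second_derivative_linear.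
Qed.

Let W_quotient0 i x : W_quotient i (fun=> 0) x = fun=> 0.
Proof. by apply/funext => e; rewrite /W_quotient /slice subrr mul0r. Qed.

Lemma partial_W0 i : partial_W W i (fun=> 0) = fun=> 0.
Proof.
by apply/funext => x; apply: partial_W_unique; rewrite W_quotient0; exact: cvg_cst.
Qed.

Lemma W_smooth0 : W_smooth (fun=> 0).
Proof.
split.
- exact: L2_0.
- by move=> i x; rewrite W_quotient0 partial_W0; exact: cvg_cst.
- by move=> i; rewrite partial_W0; exact: L2_0.
- by move=> i; rewrite partial_W0 Rintegral_cst// mul0r.
- move=> i; exists (fun=> 0); split; first exact: L2_0.
  by apply: aeW => x; rewrite partial_W0; exact: is_derive_cst.
Qed.

Section tensor.
Variables (phi G : 'I_d -> R -> R) (lambda : 'I_d -> R).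
Hypothesis reg : forall k, W_regular (W k) (phi k) (fun u => lambda k * phi k u) (G k).

Definition tensor_deriv i : X -> R := tensor (fun k => if k == i then G k else phi k).

Let rest i x := \prod_(k < d | k != i) phi k (tnth x k).

Let tensor_split i x : tensor phi x = phi i (tnth x i) * rest i x.
Proof. by rewrite /tensor (bigD1 i). Qed.

Let tensor_deriv_split i x : tensor_deriv i x = G i (tnth x i) * rest i x.
Proof.
rewrite /tensor_deriv /tensor (bigD1 i)//= eqxx; congr (_ * _).
by apply: eq_bigr => k /negbTE ->.
Qed.

Let upd i x u : X := [tuple (if k == i then u else tnth x k) | k < d].

Let rest_upd i x u : rest i (upd i x u) = rest i x.
Proof. by apply: eq_bigr => k /negbTE ki; rewrite tnth_mktuple ki. Qed.

Let tnth_upd i x u : tnth (upd i x u) i = u.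
Proof. by rewrite tnth_mktuple eqxx. Qed.

Let slice_tensor i x u : slice (tensor phi) i x u = phi i u * rest i x.
Proof. by rewrite [LHS](tensor_split i (upd i x u)) tnth_upd rest_upd. Qed.

Let slice_tensor_deriv i x u : slice (tensor_deriv i) i x u = G i u * rest i x.
Proof. by rewrite [LHS](tensor_deriv_split i (upd i x u)) tnth_upd rest_upd. Qed.

Let quotient_tensor i x : W_quotient i (tensor phi) x e @[e --> 0^'] --> tensor_deriv i x.
Proof.
rewrite tensor_deriv_split.
rewrite (_ : W_quotient i (tensor phi) x = fun e =>
  (phi i (tnth x i + e) - phi i (tnth x i)) / (W i (tnth x i + e) - W i (tnth x i)) *
  rest i x); last first.
  by apply/funext => e; rewrite /W_quotient !slice_tensor; ring.
by apply: cvgM; [exact: (regular_cvg (reg i))|exact: cvg_cst].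
Qed.

Lemma partial_W_tensor i : partial_W W i (tensor phi) = tensor_deriv i.
Proof. by apply/funext => x; apply: partial_W_unique; exact: quotient_tensor. Qed.

Lemma tensor_L2 : tensor phi \in Lfun dx 2%:E.
Proof. by apply: L2_tensor => k; exact: regular_L2 (reg k). Qed.

Lemma tensor_deriv_L2_factor i k : (if k == i then G k else phi k) \in
  Lfun (if k == i then dW_torus (W i) else dx_torus) 2%:E.
Proof.
case: eqP => [->|_]; first exact: regular_deriv_L2 (reg i).
exact: regular_L2 (reg k).
Qed.

Lemma tensor_deriv_L2 i : tensor_deriv i \in Lfun (dxW W i) 2%:E.
Proof. by apply: L2_tensor => k; exact: tensor_deriv_L2_factor. Qed.

Lemma second_derivative_tensor i :
  second_derivative i (tensor phi) (fun x => lambda i * tensor phi x).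
Proof.
split; first by apply: L2Z; exact: tensor_L2.
(* The exceptional null set of the i-th factor becomes a null cylinder. *)
have := ae_tnth (mu := fun=> dx_torus) (i := i) (regular_derive (reg i)).
apply: filterS => x [der dE]; rewrite partial_W_tensor.
rewrite (_ : slice _ i x = rest i x *: G i); last first.
  by apply/funext => u; rewrite slice_tensor_deriv mulrC.
rewrite (_ : lambda i * _ = rest i x *: (lambda i * phi i (tnth x i))).
  by apply: is_deriveZ; split => //; rewrite -derive1E.
by rewrite (tensor_split i) /GRing.scale/=; ring.
Qed.

Lemma W_smooth_tensor : W_smooth (tensor phi).
Proof.
split.
- exact: tensor_L2.
- by move=> i x; rewrite partial_W_tensor; exact: quotient_tensor.
- by move=> i; rewrite partial_W_tensor; exact: tensor_deriv_L2.
- move=> i; rewrite partial_W_tensor.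
  have iF k : (if k == i then dW_torus (W i) else dx_torus).-integrable setT
      (EFin \o (if k == i then G k else phi k)).
    apply/Lfun1_integrable; apply: Lfun_subset12 (tensor_deriv_L2_factor i k).
    exact: fin_num_measure.
  have [_ ->] := integral_tensor iF.
  by rewrite (bigD1 i)//= eqxx (regular_mean0 (reg i)) mul0r.
- by move=> i; eexists; exact: second_derivative_tensor.
Qed.
End tensor.

End differentiable.

(** * Integration by parts on the span of the tensor eigenvectors *)

Section DW_calculus.
Context {R : realType} {d : nat}.
Variables (W : 'I_d -> cumulative R R) (A : 'I_d -> set (R -> R)).
Hypothesis W_adm : forall k, W_admissible (W k).
Hypothesis A_basis : forall k, eigenbasis (W k) (A k).
Local Notation T := (measurableTypeR R).
Local Notation X := (d.-tuple T).
Local Notation dx := (@dx R d).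
Implicit Types (f g h : X -> R) (i : 'I_d).

(** Both sides factor over the coordinates. The i-th factor is one-dimensional integration by parts,
    where the eigenvalue comes out; the other factors coincide. *)
Lemma ip_tensor_deriv (phi psi G H : 'I_d -> R -> R) (lambda mu : 'I_d -> R) i :
  (forall k, W_regular (W k) (phi k) (fun u => lambda k * phi k u) (G k)) ->
  (forall k, W_regular (W k) (psi k) (fun u => mu k * psi k u) (H k)) ->
  ip (dxW W i) (tensor_deriv phi G i) (tensor_deriv psi H i) =
  - lambda i * ip dx (tensor phi) (tensor psi).
Proof.
move=> rphi rpsi.
rewrite [LHS](@ip_tensor _ _ _ _
  (fun k => if k == i then dW_torus (W i) else dx_torus)); last 2 first.
- by move=> k; exact: (tensor_deriv_L2_factor rphi).
- by move=> k; exact: (tensor_deriv_L2_factor rpsi).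
rewrite [X in _ * X](@ip_tensor _ _ _ _ (fun=> dx_torus)); last 2 first.
- by move=> k; exact: regular_L2 (rphi k).
- by move=> k; exact: regular_L2 (rpsi k).
rewrite (bigD1 i)//= eqxx [in RHS](bigD1 i)//= mulrA; congr (_ * _).
  have := regular_integration_by_parts (rphi i) (rpsi i).
  rewrite ipZl ?(regular_L2 (rphi i)) ?(regular_L2 (rpsi i))// => h.
  by rewrite mulNr h opprK.
by apply: eq_bigr => k /negbTE ->.
Qed.

Definition parts f g := forall i,
  ip dx (partial_x i (partial_W W i f)) g =
  - ip (dxW W i) (partial_W W i f) (partial_W W i g).

Lemma ip_second i f dd g : second_derivative W i f dd ->
  ip dx (partial_x i (partial_W W i f)) g = ip dx dd g.
Proof.
by move=> /second_derivative_ae h; apply: eq_ae_ip => //; exact: aeW.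
Qed.

Lemma parts_linear_l f f' g (c : R) : W_smooth W f -> W_smooth W f' -> W_smooth W g ->
  parts f g -> parts f' g -> parts (fun x => f x + c * f' x) g.
Proof.
move=> sf sf' sg p p' i.
have [ddf hf] := smooth_second sf i; have [ddf' hf'] := smooth_second sf' i.
have ef := ip_second g hf; have ef' := ip_second g hf'.
rewrite (ip_second g (second_derivative_linear c sf sf' hf hf')) partial_W_linear//.
have g2 := smooth_L2 sg; case: hf hf' => [f2 _] [f'2 _].
rewrite (ipDZl c f2 f'2 g2) -ef -ef' p p'.
have -> := ipDZl c (smooth_partial_L2 sf i) (smooth_partial_L2 sf' i) (smooth_partial_L2 sg i).
by rewrite mulrN opprD.
Qed.

Lemma parts_linear_r f g g' (c : R) : W_smooth W f -> W_smooth W g -> W_smooth W g' ->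
  parts f g -> parts f g' -> parts f (fun x => g x + c * g' x).
Proof.
move=> sf sg sg' p p' i.
have [ddf hf] := smooth_second sf i.
have e1 := ip_second g hf; have e2 := ip_second g' hf.
rewrite (ip_second _ hf) partial_W_linear//.
have g2 := smooth_L2 sg; have g'2 := smooth_L2 sg'; case: hf => [f2 _].
rewrite (ipDZr c g2 g'2 f2) -e1 -e2 p p'.
have -> := ipDZr c (smooth_partial_L2 sg i) (smooth_partial_L2 sg' i) (smooth_partial_L2 sf i).
by rewrite mulrN opprD.
Qed.

Lemma parts_tensor (phi psi G H : 'I_d -> R -> R) (lambda mu : 'I_d -> R) :
  (forall k, W_regular (W k) (phi k) (fun u => lambda k * phi k u) (G k)) ->
  (forall k, W_regular (W k) (psi k) (fun u => mu k * psi k u) (H k)) ->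
  parts (tensor phi) (tensor psi).
Proof.
move=> rphi rpsi i.
rewrite (ip_second _ (second_derivative_tensor rphi i)).
rewrite !(partial_W_tensor rphi, partial_W_tensor rpsi) (ip_tensor_deriv _ rphi rpsi).
rewrite ipZl ?mulNr ?opprK//; [exact: tensor_L2 rphi|exact: tensor_L2 rpsi].
Qed.

Lemma parts0l g : parts (fun=> 0) g.
Proof.
move=> i; rewrite !partial_W0 ip0l oppr0 -[RHS](ip0l dx g); apply: eq_ip => // x.
by rewrite /partial_x /slice derive1E derive_cst.
Qed.

Lemma parts0r f : parts f (fun=> 0).
Proof. by move=> i; rewrite partial_W0 !(ipC _ _ (fun=> 0)) !ip0l oppr0. Qed.

Lemma AW_tensor e : AW A e -> exists phi lambda G, e = tensor phi /\
  forall k, W_regular (W k) (phi k) (fun u => lambda k * phi k u) (G k).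
Proof.
move=> [phi [Aphi ->]].
have /choice[lG hlG] k : exists lG : R * (R -> R),
    W_regular (W k) (phi k) (fun u => lG.1 * phi k u) lG.2.
  have [_ /(_ _ (Aphi k)) [_ [l /(L_graph_regular (W_adm k))[G rG]]] _ _] := A_basis k.
  by exists (l, G).
by exists phi, (fun k => (lG k).1), (fun k => (lG k).2).
Qed.

Lemma DW_ind (P : (X -> R) -> Prop) : P (fun=> 0) ->
  (forall f e c, P f -> AW A e -> P (fun x => f x + c * e x)) ->
  forall f, DW A f -> P f.
Proof.
move=> P0 PS f [n [c [e [Ae ->]]]]; elim: n c e Ae => [|n ih] c e Ae.
  by under eq_fun do rewrite big_ord0.
under eq_fun do rewrite big_ord_recr/=.
by apply: PS; [exact: (ih (fun j => c (widen_ord (leqnSn n) j)))|exact: Ae].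
Qed.

Lemma DW0 : DW A (fun=> 0).
Proof.
exists 0%N, (fun=> 0), (fun=> fun=> 0); split; first by case.
by apply/funext => x; rewrite big_ord0.
Qed.

Lemma DW_linear f g (c : R) : DW A f -> DW A g -> DW A (fun x => f x + c * g x).
Proof.
move=> [n [a [e [Ae ->]]]] [m [b [e' [Ae' ->]]]].
exists (n + m)%N,
  (fun j : 'I_(n + m) => match fintype.split j with inl k => a k | inr k => c * b k end),
  (fun j : 'I_(n + m) => match fintype.split j with inl k => e k | inr k => e' k end); split.
  by move=> j; case: fintype.split.
apply/funext => x; rewrite big_split_ord/= mulr_sumr; congr (_ + _).
- by apply: eq_bigr => k _; rewrite (unsplitK (inl k)).
- by apply: eq_bigr => k _; rewrite (unsplitK (inr k)) mulrA.
Qed.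

Lemma DWB f g : DW A f -> DW A g -> DW A (f \- g).
Proof.
move=> Df Dg; have := DW_linear (-1) Df Dg.
by congr (DW A _); apply/funext => x; rewrite mulN1r.
Qed.

Lemma DW_smooth f : DW A f -> W_smooth W f.
Proof.
move: f; apply: DW_ind => [|f e c sf /AW_tensor[phi [l [G [-> r]]]]].
  exact: W_smooth0.
by apply: W_smooth_linear => //; exact: W_smooth_tensor r.
Qed.

(** Bilinearity reduces to two tensor products, by induction on [f] and then on [g]. [W_smooth] is
    carried through both inductions because [partial_W] is additive only where the limits exist. *)
Lemma DW_parts f g : DW A f -> DW A g -> parts f g.
Proof.
move=> Df Dg; have sg := DW_smooth Dg.
suff [] : W_smooth W f /\ parts f g by [].
move: f Df; apply: DW_ind => [|f e c [sf pf] /AW_tensor[phi [l [G [-> r]]]]].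
  by split; [exact: W_smooth0|exact: parts0l].
have se := W_smooth_tensor r.
split; first exact: W_smooth_linear.
apply: (parts_linear_l _ sf se sg pf).
suff [] : W_smooth W g /\ parts (tensor phi) g by [].
move: g Dg {sg pf}; apply: DW_ind => [|g e' c' [sg pg] /AW_tensor[psi [m [H [-> s]]]]].
  by split; [exact: W_smooth0|exact: parts0r].
have se' := W_smooth_tensor s.
split; first exact: W_smooth_linear.
exact: (parts_linear_r _ se sg se' pg (parts_tensor r s)).
Qed.

End DW_calculus.

(** * Enumerations of the eigenbases and of their tensor products *)

Section basis.
Context {R : realType} (V : cumulative R R).
Hypothesis V_adm : W_admissible V.
Local Notation dx1 := (@dx_torus R).

(** Supplies a derivative and an eigenvalue for the zero functions that pad an enumeration. *)
Lemma L_graph0 : L_graph V (fun=> 0) (fun=> 0).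
Proof.
have F0 (mu : {measure set (measurableTypeR R) -> \bar R}) (D : set R) :
    \int[mu]_(z in D) (0 : R) = 0.
  by rewrite /Rintegral integral0.
split => //; first exact: L2_0.
- exact: L2_0.
- exists 0, 0; split.
    rewrite (@eq_Rintegral _ _ _ _ _ (fun=> 0)) ?F0// => y _.
    by rewrite F0 addr0.
  move=> x _; rewrite (@eq_Rintegral _ _ _ _ _ (fun=> 0)) ?F0 ?mul0r ?addr0// => y _.
Qed.

(* Indices that are not the code of an element of [A] are sent to the zero
   function. *)
Record enumerates (A : set (R -> R)) (E G : nat -> R -> R) (lambda : nat -> R) : Prop :=
  Enumerates {
  enum_mem : forall j, A (E j) \/ E j = fun=> 0;
  enum_regular : forall j, W_regular V (E j) (fun u => lambda j * E j u) (G j);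
  enum_ortho : forall j l, j != l -> ip dx1 (E j) (E l) = 0;
  enum_norm : forall j, ip dx1 (E j) (E j) = 0 \/ ip dx1 (E j) (E j) = 1;
  enum_total : L2_total dx1 E
}.

(** [E j] is the basis element with code j, or 0 if there is none. Distinct indices give orthogonal
    functions because an element has one code; totality survives because the code is injective, so
    every element is the value of [E] at its own code. *)
Lemma eigenbasis_enum A : eigenbasis V A -> exists E G lambda, enumerates A E G lambda.
Proof.
move=> [/countable_injP[code code_inj] A_eigen A_ip A_total].
have /choice[E hE] j : exists e : R -> R,
    (A e /\ code e = j) \/ (e = (fun=> 0) /\ forall e', A e' -> code e' != j).
  have [[e [Ae ej]]|h] := pselect (exists e, A e /\ code e = j).
    by exists e; left.
  exists (fun=> 0); right; split => // e' Ae'; apply/eqP => e'j.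
  by apply: h; exists e'.
have /choice[lG hlG] j : exists lG : R * (R -> R),
    W_regular V (E j) (fun u => lG.1 * E j u) lG.2.
  have [[/A_eigen[_ [l /(L_graph_regular V_adm)[G rG]]] _]|[-> _]] := hE j.
    by exists (l, G).
  have [G rG] := L_graph_regular V_adm L_graph0.
  exists (0, G); move: rG; congr (W_regular _ _ _ _).
  by apply/funext => u; rewrite mul0r.
exists E, (fun j => (lG j).2), (fun j => (lG j).1); split.
- by move=> j; have [[? _]|[? _]] := hE j; [left|right].
- exact: hlG.
- move=> j l jl.
  have [[Aj cj]|[-> _]] := hE j; last exact: ip0l.
  have [[Al cl]|[-> _]] := hE l; last by rewrite ipC ip0l.
  rewrite A_ip//; case: eqP => // ejl; move: jl.
  by rewrite -cj -cl ejl eqxx.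
- move=> j; have [[Aj _]|[-> _]] := hE j; last by left; exact: ip0l.
  by right; rewrite A_ip// eqxx.
- move=> h h2 hh; apply: A_total => // e Ae; rewrite ipC.
  suff <- : E (code e) = e by exact: hh.
  have [[Aj cj]|[_ /(_ _ Ae)]] := hE (code e); last by rewrite eqxx.
  by apply: code_inj => //; apply/mem_set.
Qed.
End basis.

Section tensor_basis.
Context {R : realType} {d : nat}.
Variables (W : 'I_d -> cumulative R R) (A : 'I_d -> set (R -> R)).
Hypothesis W_adm : forall k, W_admissible (W k).
Hypothesis A_basis : forall k, eigenbasis (W k) (A k).
Local Notation T := (measurableTypeR R).
Local Notation X := (d.-tuple T).
Local Notation dx := (@dx R d).

(** Multi-indices are coded by natural numbers so that Fourier sums are sequences. Numbers coding no
    multi-index, and multi-indices with a padded factor, yield the zero function; hence squared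
    norms 0 or 1. *)
Lemma tensor_basis : exists (u : nat -> X -> R) (mu : nat -> 'I_d -> R),
  [/\ forall n, DW A (u n),
      forall n m, n != m -> ip dx (u n) (u m) = 0,
      forall n, ip dx (u n) (u n) = 0 \/ ip dx (u n) (u n) = 1,
      L2_total dx u &
      forall n i, (forall g : X -> R, ip dx (partial_x i (partial_W W i (u n))) g =
                    ip dx (fun x => mu n i * u n x) g) /\
        forall m, ip (dxW W i) (partial_W W i (u n)) (partial_W W i (u m)) =
          - mu n i * ip dx (u n) (u m)].
Proof.
have /choice[EGl hE] k : exists EGl : (nat -> R -> R) * (nat -> R -> R) * (nat -> R),
    enumerates (W k) (A k) EGl.1.1 EGl.1.2 EGl.2.
  have [E [G [l h]]] := eigenbasis_enum (W_adm k) (A_basis k).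
  by exists (E, G, l).
pose E k := (EGl k).1.1; pose G k := (EGl k).1.2; pose l k := (EGl k).2.
pose J := {ffun 'I_d -> nat}.
pose t (a : J) : X -> R := tensor (fun k => E k (a k)).
have reg (a : J) k : W_regular (W k) (E k (a k)) (fun u => l k (a k) * E k (a k) u) (G k (a k)).
  exact: enum_regular (hE k) (a k).
pose u n := if pickle_inv n is Some a then t a else fun=> 0.
pose mu n i := if pickle_inv n is Some a then l i ((a : J) i) else 0.
have ipt (a b : J) : ip dx (t a) (t b) = \prod_(k < d) ip dx_torus (E k (a k)) (E k (b k)).
  by apply: (@ip_tensor _ _ _ _ (fun=> dx_torus)) => k;
    [exact: regular_L2 (reg a k)|exact: regular_L2 (reg b k)].
exists u, mu; split.
- move=> n; rewrite /u; case: pickle_inv => [a|]; last exact: DW0.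
  (* A product with a zero factor belongs to the span as the empty sum; otherwise every factor is a
     genuine basis element. *)
  have [[k Ek]|h] := pselect (exists k, E k (a k) = fun=> 0).
    rewrite (_ : t a = fun=> 0); first exact: DW0.
    by apply/funext => x; rewrite /t /tensor (bigD1 k)//= Ek mul0r.
  exists 1%N, (fun=> 1), (fun=> t a); split.
    move=> _; exists (fun k => E k (a k)); split => // k.
    have [//|Ek] := enum_mem (hE k) (a k).
    by exfalso; apply: h; exists k.
  by apply/funext => x; rewrite big_ord1 mul1r.
- move=> n m nm; rewrite /u.
  case pn : pickle_inv => [a|]; last exact: ip0l.
  case pm : pickle_inv => [b|]; last by rewrite ipC ip0l.
  have [k abk] : exists k, a k != b k.
    apply: contrapT => h; move: nm.
    have := @pickle_invK J n; have := @pickle_invK J m; rewrite pn pm/= => <- <-.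
    have -> : a = b; last by rewrite eqxx.
    by apply/ffunP => k; apply: contrapT => /eqP abk; apply: h; exists k.
  by rewrite ipt (bigD1 k)//= (enum_ortho (hE k))// mul0r.
- move=> n; rewrite /u; case: pickle_inv => [a|]; last by left; exact: ip0l.
  rewrite ipt; elim/big_ind : _ => [|x y [->|->] [->|->]|k _]; rewrite ?mulr0 ?mulr1; auto.
  exact: enum_norm (hE k) (a k).
- move=> h h2 hh.
  apply: (@total_tensor _ _ _ d (fun=> dx_torus) nat E) => //.
  + by move=> k j; exact: regular_L2 (enum_regular (hE k) j).
  + by move=> k; exact: enum_total (hE k).
  + by move=> a; have := hh (pickle a); rewrite /u pickleK_inv.
- move=> n i; rewrite /u /mu; case: (pickle_inv n) => [a|]; split.
  + by move=> g; rewrite (ip_second g (second_derivative_tensor (reg a) i)).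
  + move=> m; case: (pickle_inv m) => [b|].
      by rewrite !(partial_W_tensor (reg _)) (ip_tensor_deriv i (reg a) (reg b)).
    by rewrite partial_W0 !(ipC _ _ (fun=> 0)) !ip0l mulr0.
  + move=> g; rewrite (parts0l _ g i) partial_W0 ip0l oppr0.
    by rewrite -[LHS](ip0l dx g); apply: eq_ip => // x; rewrite mul0r.
  + by move=> m; rewrite partial_W0 oppr0 mul0r ip0l.
Qed.
End tensor_basis.

(** * The W-Sobolev space *)

Section Sobolev.
Context {R : realType} {d : nat}.
Variables (W : 'I_d -> cumulative R R) (A : 'I_d -> set (R -> R)).
Hypothesis W_adm : forall k, W_admissible (W k).
Hypothesis A_basis : forall k, eigenbasis (W k) (A k).
Local Notation T := (measurableTypeR R).
Local Notation X := (d.-tuple T).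
Local Notation dx := (@dx R d).
Implicit Types (f g h : X -> R) (i : 'I_d).

Let DWs h (Dh : DW A h) : W_smooth W h := DW_smooth W_adm A_basis Dh.

Lemma partial_WB i f g : W_smooth W f -> W_smooth W g ->
  partial_W W i (f \- g) = partial_W W i f \- partial_W W i g.
Proof.
move=> sf sg; rewrite (_ : f \- g = fun x => f x + -1 * g x).
  by rewrite (partial_W_linear i (-1) sf sg); apply/funext => x /=; rewrite mulN1r.
by apply/funext => x; rewrite mulN1r.
Qed.

Lemma weak_derivativeB i f g F G : f \in Lfun dx 2%:E -> g \in Lfun dx 2%:E ->
  weak_derivative W A i f F -> weak_derivative W A i g G ->
  weak_derivative W A i (f \- g) (F \- G).
Proof.
move=> f2 g2 [F2 F0 wF] [G2 G0 wG].
have int1 (u : X -> R) : u \in Lfun (dxW W i) 2%:E ->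
    (dxW W i).-integrable setT (EFin \o u).
  by move=> u2; apply/Lfun1_integrable; apply: Lfun_subset12 u2; exact: fin_num_measure.
split; first exact: L2B.
  by rewrite RintegralB//; [rewrite F0 G0 subrr|exact: int1|exact: int1].
move=> h Dh; have sh := DWs Dh; have [dd hdd] := smooth_second sh i.
have h1 := wF h Dh; have h2 := wG h Dh.
rewrite (ip_second _ hdd) in h1; rewrite (ip_second _ hdd) in h2.
case: (hdd) => dd2 _.
rewrite (ip_second _ hdd) (ipBr f2 g2 dd2) h1 h2.
have -> := ipBr F2 G2 (smooth_partial_L2 sh i).
by rewrite opprB opprK addrC.
Qed.

Lemma weak_derivative_DW i h : DW A h -> weak_derivative W A i h (partial_W W i h).
Proof.
move=> Dh; have sh := DWs Dh; split; first exact: smooth_partial_L2.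
  exact: smooth_partial_mean0.
by move=> f Df; exact: (DW_parts W_adm A_basis Df Dh).
Qed.

(** On the span the energetic norm is the Sobolev norm, so energetic Cauchy sequences are those for
    which the function and each derivative are Cauchy in their L^2 spaces. *)
Lemma energetic_ipE h : DW A h ->
  energetic_ip W h h = ip dx h h + \sum_(i < d) ip (dxW W i) (partial_W W i h) (partial_W W i h).
Proof.
move=> Dh; have sh := DWs Dh; rewrite /energetic_ip; congr (_ + _).
have /choice[dd hdd] i : exists dd, second_derivative W i h dd := smooth_second sh i.
have dd2 i : dd i \in Lfun dx 2%:E by case: (hdd i).
rewrite (@eq_ae_ip _ _ _ _ _ (fun x => - \sum_(i < d) dd i x) _ h); last 2 first.
- have : {ae dx, forall x i, partial_x i (partial_W W i h) x = dd i x}.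
    by apply: (@ae_countable _ _ _ _ 'I_d) => i; exact: second_derivative_ae (hdd i).
  by apply: filterS => x hx; rewrite /LW; congr (- _); apply: eq_bigr => i _.
- exact: aeW.
rewrite ipNl ?(smooth_L2 sh)//; last exact: L2_sum.
rewrite ip_suml ?(smooth_L2 sh)// -sumrN; apply: eq_bigr => i _.
by rewrite -(ip_second h (hdd i)) (DW_parts W_adm A_basis Dh Dh) opprK.
Qed.

(** Serves twice: to place the energetic space inside the Sobolev space, and to choose, for a
    Sobolev function, the weak derivatives to which those of the approximation converge. *)
Lemma L2_cvg_weak_derivative f (h : nat -> X -> R) :
  f \in Lfun dx 2%:E -> (forall n, DW A (h n)) -> L2_cvg dx h f ->
  (forall i, L2_cauchy (dxW W i) (fun n => partial_W W i (h n))) ->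
  exists G : 'I_d -> X -> R, forall i, weak_derivative W A i f (G i) /\
    L2_cvg (dxW W i) (fun n => partial_W W i (h n)) (G i).
Proof.
move=> f2 Dh hf hc.
have hs n := DWs (Dh n); have h2 n := smooth_L2 (hs n).
have dh2 i n := smooth_partial_L2 (hs n) i.
have /choice[G hG] i : exists G, G \in Lfun (dxW W i) 2%:E /\
    L2_cvg (dxW W i) (fun n => partial_W W i (h n)) G.
  by have [G G2 hG] := L2_complete (dh2 i) (hc i); exists G.
exists G => i; have [G2 dhG] := hG i; split => //; split => //.
(* The mean is the inner product with 1, so it passes to the L^2 limit. *)
- have c2 : (fun=> 1 : R) \in Lfun (dxW W i) 2%:E by exact: Lfun_cst.
  have := L2_cvg_ip (dh2 i) G2 c2 dhG.
  have ip1 (u : X -> R) : ip (dxW W i) u (fun=> 1) = \int[dxW W i]_x u x.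
    by apply: eq_Rintegral => x _; rewrite mulr1.
  rewrite ip1 (_ : (fun n => _) = fun=> 0); last first.
    by apply/funext => n; rewrite ip1; exact: smooth_partial_mean0.
  by move=> c; apply: (@cvg_unique _ (@Rhausdorff R) _ _ _ _ c); exact: cvg_cst.
- move=> u Du; have su := DWs Du; have [dd hdd] := smooth_second su i.
  rewrite (ip_second _ hdd); case: (hdd) => dd2 _.
  have c1 := L2_cvg_ip h2 f2 dd2 hf.
  have c2 := L2_cvg_ip (dh2 i) G2 (smooth_partial_L2 su i) dhG.
  rewrite (ipC _ dd) (ipC _ (partial_W W i u)).
  apply: (@cvg_unique _ (@Rhausdorff R) _ _ _ _ c1); rewrite (_ : (fun n => _) = fun n =>
    - ip (dxW W i) (partial_W W i (h n)) (partial_W W i u)); first exact: cvgN.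
  apply/funext => n; rewrite ipC -(ip_second (h n) hdd) (DW_parts W_adm A_basis Du (Dh n)).
  by rewrite ipC.
Qed.

Lemma Htilde_approximation g : Htilde1W W A g ->
  exists h : nat -> X -> R, [/\ forall n, DW A (h n), L2_cvg dx h g &
    forall i, L2_cauchy (dxW W i) (fun n => partial_W W i (h n))].
Proof.
move=> [g2 /choice[G wG]].
have [u [mu [Du u_ortho u_norm u_total u_mu]]] := tensor_basis W_adm A_basis.
have us n := DWs (Du n); have u2 n := smooth_L2 (us n).
pose c n := ip dx (u n) g.
(* For a padded index, where <u_n, u_n> = 0, Cauchy-Schwarz gives <u_n, g> = 0. *)
have cE n : ip dx (u n) g = c n * ip dx (u n) (u n).
  have [u0|->] := u_norm n; last by rewrite mulr1.
  rewrite u0 mulr0; have := cauchy_schwarz (u2 n) g2; rewrite u0 mul0r => h.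
  by apply/eqP; rewrite -sqrf_eq0; apply/eqP; apply/le_anti; rewrite h sqr_ge0.
pose S n (x : X) := \sum_(0 <= j < n) c j * u j x.
have S0 : S 0%N = fun=> 0 by apply/funext => x; rewrite /S big_nil.
have SS n : S n.+1 = fun x => S n x + c n * u n x.
  by apply/funext => x; rewrite /S big_nat_recr.
have DS n : DW A (S n).
  elim: n => [|n ih]; first by rewrite S0; exact: DW0.
  by rewrite SS; exact: DW_linear.
have dS i n : partial_W W i (S n) = fun x => \sum_(0 <= j < n) c j * partial_W W i (u j) x.
  elim: n => [|n ih].
    by rewrite S0 partial_W0; apply/funext => x; rewrite big_nil.
  rewrite SS (partial_W_linear i (c n) (DWs (DS n)) (us n)) ih.
  by apply/funext => x; rewrite big_nat_recr.
exists S; split => //; first exact: fourier_cvg.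
move=> i; rewrite (_ : (fun n => _) =
  fun n x => \sum_(0 <= j < n) c j * partial_W W i (u j) x); last exact/funext.
have [G2 _ wGi] := wG i.
apply: (@bessel_cauchy _ _ _ _ _ _ _ _ (G i)) => //.
- by move=> n; exact: smooth_partial_L2.
- by move=> n m nm; rewrite (u_mu n i).2 u_ortho// mulr0.
(* The weak identity reads <d u_n, G_i> = - mu c_n <u_n, u_n>, and - mu <u_n, u_n> is <d u_n, d
   u_n>: the coefficients of [g] are also those of G_i, even when mu = 0. *)
- move=> n; have := wGi _ (Du n); rewrite (u_mu n i).1 ipZl// (u_mu n i).2 cE => h.
  by apply: oppr_inj; rewrite -h; ring.
Qed.

Lemma cvg_sqrt0 (s : nat -> R) : s n @[n --> \oo] --> 0 ->
  Num.sqrt (s n) @[n --> \oo] --> 0.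
Proof.
by move=> s0; rewrite -[X in _ --> X]sqrtr0; apply: continuous_cvg s0; exact: sqrt_continuous.
Qed.

Let sqrt_lt (a e : R) : 0 < e -> (Num.sqrt a < e) = (a < e ^+ 2).
Proof.
by move=> e0; rewrite -{1}[e](gtr0_norm e0) -sqrtr_sqr ltr_sqrt// exprn_gt0.
Qed.

Lemma energetic_ipB f g : DW A f -> DW A g ->
  energetic_ip W (f \- g) (f \- g) = ip dx (f \- g) (f \- g) +
    \sum_(i < d) ip (dxW W i) (partial_W W i f \- partial_W W i g)
                              (partial_W W i f \- partial_W W i g).
Proof.
move=> Df Dg; rewrite energetic_ipE; last exact: DWB.
by congr (_ + _); apply: eq_bigr => i _; rewrite partial_WB; [|exact: DWs|exact: DWs].
Qed.

Lemma Htilde_sub_H1W f : Htilde1W W A f -> H1W W A f.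
Proof.
move=> Hf; have [h [Dh hf hc]] := Htilde_approximation Hf.
case: Hf => f2 _; split => //; exists h; split => //; first exact: cvg_sqrt0.
(* The squared energetic norm has d + 1 terms: the function and its d derivatives. *)
move=> e e0; pose del := e ^+ 2 / d.+1%:R.
have del0 : 0 < del by rewrite divr_gt0// exprn_gt0.
have h2 n := smooth_L2 (DWs (Dh n)).
have [N hN] := L2_cvg_cauchy h2 f2 hf del0.
have /choice[M hM] i := hc i _ del0.
(* The sum dominates the thresholds of all the terms simultaneously. *)
exists (N + \sum_(i < d) M i)%N => m n Nm Nn.
have NN : (N <= N + \sum_(i < d) M i)%N by rewrite leq_addr.
have NM i : (M i <= N + \sum_(i < d) M i)%N.
  by apply: leq_trans (leq_addl _ _); rewrite (bigD1 i)//= leq_addr.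
rewrite /energetic_norm sqrt_lt// energetic_ipB//.
have -> : e ^+ 2 = del + \sum_(i < d) del.
  by rewrite sumr_const card_ord -mulrS -mulr_natr /del divfK//.
apply: ltr_leD.
  by apply: hN; [exact: leq_trans Nm|exact: leq_trans Nn].
apply: ler_sum => i _; apply/ltW/hM; first exact: leq_trans Nm.
exact: leq_trans Nn.
Qed.

(** Each derivative contributes one nonnegative term to the squared energetic norm of a difference,
    so it is Cauchy on its own; the threshold sqrt e converts norms into squared norms. *)
Lemma H1W_approximation f : H1W W A f ->
  exists h : nat -> X -> R, [/\ forall n, DW A (h n), L2_cvg dx h f &
    forall i, L2_cauchy (dxW W i) (fun n => partial_W W i (h n))].
Proof.
move=> [f2 [h [Dh hf hc]]]; exists h; split => //.
  rewrite /L2_cvg (_ : (fun n => _) =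
    fun n => L2norm dx (h n \- f) * L2norm dx (h n \- f)).
    by rewrite -(mulr0 0); exact: cvgM.
  by apply/funext => n; rewrite /L2norm -expr2 sqr_sqrtr// ip_ge0.
move=> i e e0; have [|N hN] := hc (Num.sqrt e); first by rewrite sqrtr_gt0.
exists N => m n Nm Nn; have := hN m n Nm Nn.
rewrite /energetic_norm ltr_sqrt// energetic_ipB// (bigD1 i)//=.
apply: le_lt_trans; rewrite addrCA lerDl addr_ge0 ?ip_ge0// sumr_ge0// => j _.
exact: ip_ge0.
Qed.

Lemma Htilde1WE : Htilde1W W A = H1W W A.
Proof.
apply/seteqP; split; first exact: Htilde_sub_H1W.
move=> f Hf; have [h [Dh hf hc]] := H1W_approximation Hf.
case: Hf => f2 _; split => // i.
have [G hG] := L2_cvg_weak_derivative f2 Dh hf hc.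
by exists (G i); case: (hG i).
Qed.

Lemma Sobolev_norm_cvg0 f (h : nat -> X -> R) (G : 'I_d -> X -> R) :
  L2_cvg dx h f ->
  (forall i, L2_cvg (dxW W i) (fun n => partial_W W i (h n)) (G i)) ->
  Sobolev_norm W (h n \- f) (fun i => partial_W W i (h n) \- G i) @[n --> \oo] --> 0.
Proof.
move=> hf hG; apply: cvg_sqrt0; rewrite -[X in _ --> X]addr0; apply: cvgD => //.
rewrite [X in _ --> X](_ : 0 = \sum_(i < d) (0 : R)); last by rewrite big1.
by apply: cvg_big => [|i _]; [exact: add_continuous|exact: hG].
Qed.

End Sobolev.

Theorem proposition2p5 (R : realType) (d : nat)
    (W : 'I_d -> cumulative R R) (A : 'I_d -> set (R -> R))
    (d_gt0 : (0 < d)%N)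
    (W_adm : forall k, W_admissible (W k))
    (A_basis : forall k, eigenbasis (W k) (A k)) :
  Htilde1W W A = H1W W A /\
  (forall f, Htilde1W W A f ->
    exists G : 'I_d -> d.-tuple (measurableTypeR R) -> R,
      (forall i, weak_derivative W A i f (G i)) /\
      exists h : nat -> d.-tuple (measurableTypeR R) -> R,
        [/\ forall n, DW A (h n),
            forall n i, weak_derivative W A i (h n \- f)
                          (partial_W W i (h n) \- G i) &
            Sobolev_norm W (h n \- f) (fun i => partial_W W i (h n) \- G i)
              @[n --> \oo] --> 0]).
Proof.
split; first exact: Htilde1WE.
move=> f Hf; have [h [Dh hf hc]] := Htilde_approximation W_adm A_basis Hf.
case: Hf => f2 _.
(* [G] is the limit of the derivatives of [h] rather than the weak derivatives contained in the
   hypothesis on [f], which by non-uniqueness may differ from that limit. *)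
have [G hG] := L2_cvg_weak_derivative W_adm A_basis f2 Dh hf hc.
exists G; split; first by move=> i; case: (hG i).
exists h; split => // [n i|].
  have [wf _] := hG i; apply: weak_derivativeB => //.
    exact: smooth_L2 (DW_smooth W_adm A_basis (Dh n)).
  exact: weak_derivative_DW.
by apply: Sobolev_norm_cvg0 => // i; case: (hG i).
Qed.
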